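(* Let $p$ be a prime, $r\in\mathbb{N}$, $k_1,\ldots,k_r\in\mathbb{Z}$, $\gamma_1,\ldots,\gamma_r\in\mathbb{Z}_p$ and $c\in\mathbb{N}_{>1}$ with $(c,p)=1$. Then the $p$-adic multiple $L$-function has the expansion $$L_{p,r}(s_1,\ldots,s_r;\omega^{k_1},\ldots,\omega^{k_r};\gamma_1,\ldots,\gamma_r;c)=\sum_{n_1,\ldots,n_r=0}^\infty C(n_1,\ldots,n_r;(\omega^{k_j});(\gamma_j);c)\,s_1^{n_1}\cdots s_r^{n_r}$$ for all $(s_1,\ldots,s_r)\in\mathbb{C}_p^r$ with $|s_j|_p<q\,p^{-1/(p-1)}$ $(1\leqslant j\leqslant r)$, where the coefficients $C(n_1,\ldots,n_r;(\omega^{k_j});(\gamma_j);c)\in\mathbb{Z}_p$ satisfy $$\left|C(n_1,\ldots,n_r;(\omega^{k_j});(\gamma_j);c)\right|_p\leqslant\left(q\,p^{-1/(p-1)}\right)^{-n_1-\cdots-n_r}.$$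
   Context: $|\cdot|_p$ is the $p$-adic absolute value on $\mathbb{C}_p$ with $|p|_p=1/p$. Put $q=4$ if $p=2$ and $q=p$ if $p\geqslant3$. Let $W=\{\pm1\}$ if $p=2$ and $W=\{\xi\in\mathbb{Z}_p^\times\mid\xi^{p-1}=1\}$ if $p\geqslant3$. Every $x\in\mathbb{Z}_p^\times$ is uniquely $x=\omega(x)\langle x\rangle$ with $\omega(x)\in W$, $\langle x\rangle\in1+q\mathbb{Z}_p$ ($\omega$: Teichm\''uller character). For $x\in\mathbb{Z}_p^\times$, $\langle x\rangle^{-s}=\sum_{n\geqslant0}\binom{-s}{n}(\langle x\rangle-1)^n$ is defined for $s\in\mathbb{C}_p$ with $|s|_p<qp^{-1/(p-1)}$. For $z\in\mathbb{C}_p$ with $|z-1|_p\geqslant1$, $\mathfrak{m}_z$ is the measure on $\mathbb{Z}_p$ with $\mathfrak{m}_z(j+p^N\mathbb{Z}_p)=\frac{z^j}{1-z^{p^N}}$ $(0\leqslant j\leqslant p^N-1)$. For $c\in\mathbb{N}_{>1}$ prime to $p$, $\widetilde{\mathfrak{m}}_c=\sum_{\xi\in\mathbb{C}_p,\,\xi^c=1,\,\xi\neq1}\mathfrak{m}_\xi$; it is a $\mathbb{Z}_p$-valued measure. Integrals of continuous functions are limits of Riemann sums, and on $\mathbb{Z}_p^r$ one uses the product measure. Put $(\mathbb{Z}_p^r)'_{\{\gamma_j\}}=\{(x_j)\in\mathbb{Z}_p^r\mid p\nmid x_1\gamma_1,\ p\nmid(x_1\gamma_1+x_2\gamma_2),\ldots,\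 p\nmid\sum_{j=1}^rx_j\gamma_j\}$. The $p$-adic multiple $L$-function of depth $r$ is defined for $|s_j|_p<qp^{-1/(p-1)}$ by $$L_{p,r}(s_1,\ldots,s_r;\omega^{k_1},\ldots,\omega^{k_r};\gamma_1,\ldots,\gamma_r;c)=\int_{(\mathbb{Z}_p^r)'_{\{\gamma_j\}}}\prod_{i=1}^r\Bigl\langle\sum_{j=1}^ix_j\gamma_j\Bigr\rangle^{-s_i}\omega^{k_i}\Bigl(\sum_{j=1}^ix_j\gamma_j\Bigr)\prod_{j=1}^rd\widetilde{\mathfrak{m}}_c(x_j)$$ (the zero function if the domain is empty). *)

(* Defs.v *)
From HB Require Import structures.
From mathcomp Require Import all_boot all_order all_algebra finmap.
From mathcomp Require Import all_classical all_reals all_analysis.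
Import Order.TTheory GRing.Theory Num.Theory.
Import numFieldNormedType.Exports.

Set Implicit Arguments.
Unset Strict Implicit.
Unset Printing Implicit Defensive.

Local Open Scope classical_set_scope.
Local Open Scope ring_scope.

Section AbsoluteValue.
Variables (R : realType) (K : fieldType) (abs : K -> R).

Definition abs_cvg (u : nat -> K) (l : K) : Prop :=
  (fun n => abs (u n - l)) @ \oo --> (0 : R).

Definition abs_cauchy (u : nat -> K) : Prop :=
  forall e : R, 0 < e ->
    exists N : nat, forall m n, (N <= m)%N -> (N <= n)%N -> abs (u m - u n) < e.

Definition abs_closure (A : set K) : set K :=
  [set x | forall e : R, 0 < e -> exists2 a, A a & abs (x - a) < e].

(* Convergence of the net of finite partial sums (unconditional summation). *)
Definition abs_sum_to (I : choiceType) (f : I -> K) (l : K) : Prop :=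
  forall e : R, 0 < e ->
    exists F0 : {fset I}, forall F : {fset I},
      (F0 `<=` F)%fset -> abs (\sum_(i <- F) f i - l) < e.

End AbsoluteValue.

Definition algebraic_over (K : fieldType) (F : set K) (x : K) : Prop :=
  exists P : {poly K}, [/\ P != 0, forall i, F P`_i & root P x].

(* The field C_p with its p-adic absolute value: an algebraically closed field,
   complete for a non-archimedean absolute value with |p| = 1/p, in which the
   elements algebraic over Q_p are dense; here Q_p is the closure of Q. These
   elements form an algebraic closure of Q_p, so this says that the field is
   the completion of an algebraic closure of Q_p, which determines it up to
   isometric isomorphism. *)
Record padicComplexType (R : realType) (p : nat) := PadicComplex {
  padic_sort :> closedFieldType;
  pabs : padic_sort -> R;
  pabs_ge0 : forall x, 0 <= pabs x;
  pabs_eq0 : forall x, pabs x = 0 <-> x = 0;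
  pabsM : forall x y, pabs (x * y) = pabs x * pabs y;
  pabsD : forall x y, pabs (x + y) <= Num.max (pabs x) (pabs y);
  pabs_p : pabs p%:R = p%:R^-1;
  padic_complete : forall u : nat -> padic_sort,
    abs_cauchy pabs u -> exists l, abs_cvg pabs u l;
  padic_dense : forall x : padic_sort,
    abs_closure pabs
      (algebraic_over (abs_closure pabs (range (fun a : rat => ratr a)))) x
}.

Arguments pabs {R p Cp} x : rename.

(* q, and the radius q p^(-1/(p-1)) *)
Definition teich_modulus (p : nat) : nat := if p == 2%N then 4%N else p.

Definition padic_radius (R : realType) (p : nat) : R :=
  (teich_modulus p)%:R * p%:R `^ (- (p.-1%:R)^-1).

Section PadicL.
Variables (R : realType) (p : nat) (Cp : padicComplexType R p).

Definition padic_lim (u : nat -> Cp) : Cp :=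
  xget 0 [set l | abs_cvg (@pabs R p Cp) u l].

Definition padicQ : set Cp := abs_closure (@pabs R p Cp) (range (fun a : rat => ratr a)).

Definition padicZ : set Cp := [set x | padicQ x /\ pabs x <= 1].

(* x = y mod a Z_p; for x in Z_p, p does not divide x iff ~ padicZ_eqmod p%:R x 0 *)
Definition padicZ_eqmod (a x y : Cp) : Prop := exists2 t, padicZ t & x - y = a * t.

Definition padicZ_unit : set Cp := [set x | padicZ x /\ ~ padicZ_eqmod p%:R x 0].

Definition teich_group : set Cp :=
  if p == 2%N then [set 1; -1]
  else [set xi | padicZ_unit xi /\ xi ^+ p.-1 = 1].

(* For x in Z_p^*, the unique element of W with x / omega(x) in 1 + q Z_p. *)
Definition teich (x : Cp) : Cp :=
  xget 0 [set w | teich_group w /\ padicZ_eqmod (teich_modulus p)%:R (x / w) 1].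

Definition diamond (x : Cp) : Cp := x / teich x.

Definition gbinom (a : Cp) (n : nat) : Cp :=
  (\prod_(i < n) (a - i%:R)) / (n`!)%:R.

Definition diamond_pow (x a : Cp) : Cp :=
  padic_lim (fun N => \sum_(n < N) gbinom a n * (diamond x - 1) ^+ n).

(* A measure on Z_p is given by its values m N j on the balls j + p^N Z_p,
   0 <= j < p^N. *)
Definition ball_measure := nat -> nat -> Cp.

Definition koblitz_measure (z : Cp) : ball_measure :=
  fun N j => z ^+ j / (1 - z ^+ (p ^ N)%N).

Definition mtilde (c : nat) : ball_measure :=
  fun N j =>
    \sum_(xi \in [set xi : Cp | xi ^+ c = 1 /\ xi != 1]) koblitz_measure xi N j.

Section Integral.
Variable r : nat.

Definition ball_tag (N : nat) (t : {ffun 'I_r -> 'I_(p ^ N)} -> 'I_r -> Cp) :=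
  forall j i, padicZ (t j i) /\ padicZ_eqmod (p ^ N)%:R (t j i) (j i)%:R.

(* I is the limit of the Riemann sums of f over Z_p^r for the r-fold product of
   m, whatever the sample point chosen in each product of balls of radius p^-N. *)
Definition is_padic_integral (m : ball_measure) (f : ('I_r -> Cp) -> Cp)
    (I : Cp) : Prop :=
  forall e : R, 0 < e -> exists N0 : nat, forall N, (N0 <= N)%N ->
    forall t : {ffun 'I_r -> 'I_(p ^ N)} -> 'I_r -> Cp, ball_tag t ->
      pabs (\sum_(j : {ffun 'I_r -> 'I_(p ^ N)})
              f (t j) * \prod_(i < r) m N (j i) - I) < e.

Definition padic_integral (m : ball_measure) (D : set ('I_r -> Cp))
    (f : ('I_r -> Cp) -> Cp) : Cp :=
  xget 0 [set I | is_padic_integral m (fun x => \1_D x * f x) I].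

Definition partial_dot (x gamma : 'I_r -> Cp) (i : 'I_r) : Cp :=
  \sum_(j < r | (j <= i)%N) x j * gamma j.

Definition padic_L_domain (gamma : 'I_r -> Cp) : set ('I_r -> Cp) :=
  [set x | (forall j, padicZ (x j)) /\
           (forall i, ~ padicZ_eqmod p%:R (partial_dot x gamma i) 0)].

Definition padic_L (s : 'I_r -> Cp) (k : 'I_r -> int) (gamma : 'I_r -> Cp)
    (c : nat) : Cp :=
  padic_integral (mtilde c) (padic_L_domain gamma)
    (fun x => \prod_(i < r)
       (diamond_pow (partial_dot x gamma i) (- s i) *
        teich (partial_dot x gamma i) ^ k i)).

End Integral.
End PadicL.

Arguments padicZ {R p} Cp x.

(* Main.v *)
(* The binomial expansion of <y>^(-s) is a double series: binom(-s, n) is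
   1/n! times a polynomial in s with integer coefficients, so that
   <y>^(-s) = sum_m a_m(<y> - 1) s^m, where a_m(u) is the sum over n >= m of
   integer multiples of u^n / n!. As |u| <= 1/q and (p - 1) v_p(n!) <= n, the
   n-th term has absolute value at most rho^(-n) with rho = q p^(-1/(p-1)) > 1.
   Hence a_m is Z_p-valued, q-Lipschitz and bounded by rho^(-m), and the
   expansion converges uniformly in y for |s| < rho. The measure is Z_p-valued
   since 1/(1 - xi) = -(1/c) sum_(k < c) k xi^k for xi^c = 1, xi <> 1; so
   integration over Z_p^r does not increase the sup norm, and the product of the
   r expansions may be integrated term by term. *)
Require Import Defs.
From mathcomp Require Import all_boot all_order all_algebra finmap cyclic separable cyclotomic.
From mathcomp Require Import all_classical all_reals all_analysis.
From mathcomp Require Import ring zify.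
Import Order.TTheory GRing.Theory Num.Theory.
Import numFieldNormedType.Exports.
Set Implicit Arguments.
Unset Strict Implicit.
Unset Printing Implicit Defensive.
Local Open Scope ring_scope.

(** * The absolute value and the ring of p-adic integers *)

Section PadicL.
Variables (R : realType) (p : nat) (hp : prime p) (Cp : padicComplexType R p).
Implicit Types (x y z w l : Cp) (u v : nat -> Cp) (e B : R).
Local Notation q := (teich_modulus p).
Local Notation padic_cvg := (abs_cvg (@pabs R p Cp)).

(** Limits, integrals and Teichmueller representatives are all picked by [xget] with default 0, so
    each must be shown to exist before its value carries information. For the integrals this
    requires uniform continuity of an integrand that is cut off by an indicator and contains the
    Teichmueller character. Both are constant on balls of radius 1/q, on which the diamond part
    varies isometrically.

    The radius comes from Legendre's formula: |1/n!| grows at most like p^(n/(p-1)), against q^(-n)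
    for the n-th power of a point of the disc |u| <= 1/q. At p = 2 the choice q = 2 would give rho =
    1; q = 4 is what makes rho > 1.

    No infinite sum is put under the integral. Truncating every expansion at exponent M changes the
    integrand uniformly by at most the largest theta_i^M, where theta_i = max(1, |s_i|) / rho < 1,
    and this bound passes to the integral of the difference. Unconditional summation follows, since
    the terms outside a box of exponents contribute at most the largest of them. *)

Lemma p_gt0R : 0 < p%:R :> R.
Proof. by rewrite ltr0n prime_gt0. Qed.

Lemma invp_lt1 : (p%:R : R)^-1 < 1.
Proof. by rewrite invf_lt1 ?p_gt0R // ltr1n prime_gt1. Qed.

Lemma pabs0 : pabs (0 : Cp) = 0.
Proof. exact/pabs_eq0. Qed.

Lemma pabs_neq0 x : (pabs x != 0) = (x != 0).
Proof. by congr (~~ _); apply/eqP/eqP => /pabs_eq0. Qed.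

Lemma pabs_gt0 x : (0 < pabs x) = (x != 0).
Proof. by rewrite lt_def pabs_ge0 andbT pabs_neq0. Qed.

Lemma pabs1 : pabs (1 : Cp) = 1.
Proof.
have /mulfI : pabs (1 : Cp) != 0 by rewrite pabs_neq0 oner_eq0.
by apply; rewrite -pabsM !mulr1.
Qed.

Lemma pabsN x : pabs (- x) = pabs x.
Proof.
suff h : pabs (-1 : Cp) = 1 by rewrite -mulN1r pabsM h mul1r.
apply/eqP; rewrite -(@pexpr_eq1 _ _ 2) ?pabs_ge0 //.
by rewrite expr2 -pabsM mulrNN mulr1 pabs1.
Qed.

Lemma pabsBC x y : pabs (x - y) = pabs (y - x).
Proof. by rewrite -pabsN opprB. Qed.

Lemma pabsV x : pabs x^-1 = (pabs x)^-1.
Proof.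
have [->|x0] := eqVneq x 0; first by rewrite invr0 pabs0 invr0.
have h : pabs x != 0 by rewrite pabs_neq0.
by apply: (mulfI h); rewrite -pabsM !divff ?pabs1.
Qed.

Lemma pabsX x n : pabs (x ^+ n) = pabs x ^+ n.
Proof. by elim: n => [|n IH]; rewrite ?expr0 ?pabs1 // !exprS pabsM IH. Qed.

Lemma pabs_prod (I : Type) (s : seq I) (P : pred I) (F : I -> Cp) :
  pabs (\prod_(i <- s | P i) F i) = \prod_(i <- s | P i) pabs (F i).
Proof. by apply: (big_morph _ _ pabs1) => x y; rewrite pabsM. Qed.

Lemma pabsD_le x y B : pabs x <= B -> pabs y <= B -> pabs (x + y) <= B.
Proof. by move=> hx hy; apply: le_trans (pabsD _ _) _; rewrite ge_max hx. Qed.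

Lemma pabsD_lt x y B : pabs x < B -> pabs y < B -> pabs (x + y) < B.
Proof. by move=> hx hy; apply: le_lt_trans (pabsD _ _) _; rewrite gt_max hx. Qed.

Lemma pabsB_le x y B : pabs x <= B -> pabs y <= B -> pabs (x - y) <= B.
Proof. by move=> hx hy; apply: pabsD_le; rewrite ?pabsN. Qed.

Lemma pabs_dist_le z x y B :
  pabs (x - z) <= B -> pabs (z - y) <= B -> pabs (x - y) <= B.
Proof. by move=> hx hy; rewrite -(subrK z x) -addrA; apply: pabsD_le. Qed.

Lemma pabs_dist_lt z x y B :
  pabs (x - z) < B -> pabs (z - y) < B -> pabs (x - y) < B.
Proof. by move=> hx hy; rewrite -(subrK z x) -addrA; apply: pabsD_lt. Qed.

Lemma pabs_sum_le (I : Type) (s : seq I) (P : pred I) (F : I -> Cp) B :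
  0 <= B -> (forall i, P i -> pabs (F i) <= B) ->
  pabs (\sum_(i <- s | P i) F i) <= B.
Proof.
move=> B0 h; apply: (big_ind (fun x => pabs x <= B)) => //; first by rewrite pabs0.
by move=> x y; apply: pabsD_le.
Qed.

Lemma pabs_nat_le1 n : pabs (n%:R : Cp) <= 1.
Proof.
elim: n => [|n IH]; first by rewrite pabs0.
by rewrite -natr1; apply: pabsD_le => //; rewrite pabs1.
Qed.

Lemma pabs_int_le1 (m : int) : pabs (m%:~R : Cp) <= 1.
Proof. by case: m => n; rewrite ?NegzE ?mulrNz ?pabsN pabs_nat_le1. Qed.

(** The isosceles property of ultrametric triangles: if |x| < |y|, then y = x - (x - y) would be
    smaller than |y|. *)
Lemma pabs_close x y : pabs (x - y) < pabs y -> pabs x = pabs y.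
Proof.
move=> h; apply/eqP; rewrite eq_le; apply/andP; split.
  by rewrite -(subrK y x); apply: pabsD_le => //; apply: ltW.
rewrite leNgt; apply/negP => hx.
have : pabs (x - (x - y)) < pabs y by apply: pabsD_lt; rewrite ?pabsN.
by rewrite opprB addrC subrK ltxx.
Qed.

(** By Bezout 1 is a difference of multiples of p and n; if |n| < 1, both would have absolute value
    below 1, and so would 1. *)
Lemma pabs_nat_coprime n : coprime p n -> pabs (n%:R : Cp) = 1.
Proof.
move=> cpn; apply/eqP; rewrite eq_le pabs_nat_le1 /= leNgt; apply/negP => hn.
have [km kn e _] := @egcdnP p n (prime_gt0 hp).
have {e} : (km * p)%:R - (kn * n)%:R = 1 :> Cp.
  by rewrite e (eqP cpn) natrD addrC addKr.
move=> e; have : pabs (1 : Cp) < 1.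
  rewrite -{1}e; apply: pabsD_lt; rewrite ?pabsN natrM pabsM.
    rewrite pabs_p; apply: le_lt_trans invp_lt1.
    by rewrite ler_piMl ?invr_ge0 ?ler0n ?pabs_nat_le1.
  by apply: le_lt_trans hn; rewrite ler_piMl ?pabs_ge0 ?pabs_nat_le1.
by rewrite pabs1 ltxx.
Qed.

Lemma pabs_natE n : (0 < n)%N -> pabs (n%:R : Cp) = p%:R ^- logn p n.
Proof.
move=> n0; have [m pm nE] := pfactor_coprime hp n0.
by rewrite [in LHS]nE natrM natrX pabsM pabsX pabs_p pabs_nat_coprime // mul1r exprVn.
Qed.

Lemma natr_neq0 n : (0 < n)%N -> (n%:R : Cp) != 0.
Proof.
by move=> n0; rewrite -pabs_gt0 pabs_natE // invr_gt0 exprn_gt0 ?p_gt0R.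
Qed.

Lemma intr_neq0 (m : int) : m != 0 -> (m%:~R : Cp) != 0.
Proof.
by case: m => [[|n]|n] // _; rewrite ?NegzE ?mulrNz ?oppr_eq0 natr_neq0.
Qed.

Lemma pabs_dvdn N n : (p ^ N %| n)%N -> pabs (n%:R : Cp) <= p%:R ^- N.
Proof.
case/dvdnP => m ->; rewrite natrM pabsM natrX pabsX pabs_p exprVn.
by rewrite ler_piMl ?pabs_nat_le1 // invr_ge0 exprn_ge0 ?ler0n.
Qed.

Lemma pabs_eqmod N m n :
  m = n %[mod p ^ N] -> pabs (m%:R - n%:R : Cp) <= p%:R ^- N.
Proof.
wlog le_nm : m n / (n <= m)%N => [wl h|].
  by case: (leqP n m) => [|/ltnW] le; [|rewrite pabsBC]; apply: wl.
move=> /eqP; rewrite eqn_mod_dvd // => h.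
by rewrite -natrB //; apply: pabs_dvdn.
Qed.

Lemma geometric_lt (t e : R) : 0 <= t -> t < 1 -> 0 < e ->
  exists N, forall n, (N <= n)%N -> t ^+ n < e.
Proof.
move=> t0 t1 e0; have /cvgrPdist_lt /(_ _ e0) : ((fun n => t ^+ n) @ \oo --> (0 : R))%classic.
  by apply: cvg_expr; rewrite ger0_norm.
case=> N _ h; exists N => n Nn; have := h n Nn.
by rewrite /= sub0r normrN ger0_norm ?exprn_ge0.
Qed.

Lemma abs_cvgP u l : padic_cvg u l <->
  forall e, 0 < e -> exists N, forall n, (N <= n)%N -> pabs (u n - l) < e.
Proof.
split=> [/cvgrPdist_lt h e /h [N _ hN]|h].
  by exists N => n /hN /=; rewrite sub0r normrN ger0_norm ?pabs_ge0.
apply/cvgrPdist_lt => e /h [N hN]; exists N => // n /hN.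
by rewrite /= sub0r normrN ger0_norm ?pabs_ge0.
Qed.

Lemma abs_cvg_dist_le u l x B (N0 : nat) : padic_cvg u l ->
  (forall n, (N0 <= n)%N -> pabs (u n - x) <= B) -> pabs (l - x) <= B.
Proof.
move=> /abs_cvgP ul h; rewrite leNgt; apply/negP => hB.
have l0 : 0 < pabs (l - x).
  by apply: le_lt_trans hB; apply: le_trans (h N0 _); rewrite ?pabs_ge0.
have [N hN] := ul _ l0; pose n := maxn N0 N.
have : pabs (l - x) < pabs (l - x).
  apply: (@pabs_dist_lt (u n)); first by rewrite pabsBC hN // leq_maxr.
  by apply: le_lt_trans hB; rewrite h // leq_maxl.
by rewrite ltxx.
Qed.

Lemma abs_cvg_le u l B (N0 : nat) : padic_cvg u l ->
  (forall n, (N0 <= n)%N -> pabs (u n) <= B) -> pabs l <= B.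
Proof.
move=> ul h; rewrite -(subr0 l); apply: (abs_cvg_dist_le (N0 := N0) ul) => n /h.
by rewrite subr0.
Qed.

Lemma abs_cvg_unique u l l' :
  padic_cvg u l -> padic_cvg u l' -> l = l'.
Proof.
move=> ul /abs_cvgP ul'; apply/eqP; rewrite -subr_eq0; apply/eqP/pabs_eq0/eqP.
rewrite eq_le pabs_ge0 andbT; apply/ler_addgt0Pr => e; rewrite add0r => /ul' [N hN].
by apply: (abs_cvg_dist_le (N0 := N) ul) => n /hN /ltW.
Qed.

Lemma padic_limE u l : padic_cvg u l -> padic_lim u = l.
Proof.
move=> ul; apply: (@abs_cvg_unique u) (ul).
exact: (@xgetPex _ 0 [set l | padic_cvg u l]%classic (ex_intro _ l ul)).
Qed.

(** In an ultrametric field a sequence is Cauchy as soon as its consecutive differences tend to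
    0. *)
Lemma nonarch_cvg u :
  (forall e, 0 < e -> exists N, forall n, (N <= n)%N -> pabs (u n.+1 - u n) < e) ->
  exists l, padic_cvg u l.
Proof.
move=> h; apply: padic_complete => e /h [N hN].
have main n : (N <= n)%N -> pabs (u n - u N) < e.
  elim: n => [|n IH] hn.
    move: hn; rewrite leqn0 => /eqP ->; rewrite subrr pabs0.
    exact: le_lt_trans (pabs_ge0 _) (hN _ (leqnn N)).
  move: hn; rewrite leq_eqVlt => /predU1P[<-|].
    by rewrite subrr pabs0; apply: le_lt_trans (pabs_ge0 _) (hN _ (leqnn N)).
  by rewrite ltnS => hn; apply: (@pabs_dist_lt (u n)); [exact: hN | exact: IH].
exists N => m n /main hm /main hn.
by apply: pabs_dist_lt hm _; rewrite pabsBC.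
Qed.

(** Replacing [ratr] by explicit quotients of integers turns the closure of Q_p under field
    operations into arithmetic inside [Cp]. *)
Lemma padicQP x : padicQ x <-> forall e, 0 < e ->
  exists m n : int, n != 0 /\ pabs (x - m%:~R / n%:~R) < e.
Proof.
split=> h e /h.
  by case=> _ [a _ <-] ha; exists (numq a), (denq a); rewrite denq_neq0.
case=> m [n [n0 hmn]]; set a : rat := m%:~R / n%:~R.
exists (ratr a); first by exists a.
suff -> : ratr a = m%:~R / n%:~R :> Cp by [].
apply/eqP; rewrite /ratr eqr_div ?intr_neq0 ?denq_neq0 // -!intrM.
apply/eqP; congr (_%:~R); apply: (@intr_inj rat); rewrite !intrM numqE /a.
by rewrite mulrAC divfK // intr_eq0.
Qed.

Lemma padicQ_int (m : int) : padicQ (m%:~R : Cp).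
Proof. by apply/padicQP => e e0; exists m, 1; rewrite divr1 subrr pabs0. Qed.

Lemma padicQ_lim u l : padic_cvg u l ->
  (forall n, padicQ (u n)) -> padicQ l.
Proof.
move=> /abs_cvgP ul uQ; apply/padicQP => e e0; have [N /(_ _ (leqnn _)) hN] := ul _ e0.
have [m [n [n0 h]]] := (padicQP (u N)).1 (uQ N) _ e0.
by exists m, n; split=> //; apply: pabs_dist_lt h; rewrite pabsBC.
Qed.

Lemma padicQB x y : padicQ x -> padicQ y -> padicQ (x - y).
Proof.
move=> /padicQP hx /padicQP hy; apply/padicQP => e e0.
have [m [n [n0 h]]] := hx _ e0; have [m' [n' [n'0 h']]] := hy _ e0.
exists (m * n' - m' * n), (n * n'); rewrite mulf_neq0 //; split=> //.
rewrite !(intrM, intrB).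
have -> : (m%:~R * n'%:~R - m'%:~R * n%:~R) / (n%:~R * n'%:~R)
   = m%:~R / n%:~R - m'%:~R / n'%:~R :> Cp.
  by field; rewrite !intr_neq0.
set a := _ / _ in h *; set b := _ / _ in h' *.
have -> : x - y - (a - b) = x - a - (y - b) by ring.
by apply: pabsD_lt; rewrite ?pabsN.
Qed.

Lemma padicQM x y : padicQ x -> padicQ y -> padicQ (x * y).
Proof.
move=> hx hy; apply/padicQP => e e0.
(* [B] bounds both |y| and the approximation [a] of x, which lies within 1 of x; these are the two
   factors in xy - ab = (x - a) y + a (y - b). *)
pose B := pabs x + pabs y + 1.
have B0 : 0 < B by rewrite ltr_wpDl ?addr_ge0 ?pabs_ge0.
pose d := Num.min 1 (e / B).
have d0 : 0 < d by rewrite lt_min ltr01 divr_gt0.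
have [m [n [n0 h]]] := (padicQP x).1 hx _ d0.
have [m' [n' [n'0 h']]] := (padicQP y).1 hy _ d0.
exists (m * m'), (n * n'); rewrite mulf_neq0 //; split=> //.
rewrite !intrM -mulf_div; set a := _ / _ in h *; set b := _ / _ in h' *.
apply: (@pabs_dist_lt (a * y)); rewrite -(mulrBl, mulrBr) pabsM.
  apply: (@le_lt_trans _ _ (pabs (x - a) * B)).
    by rewrite ler_wpM2l ?pabs_ge0 // /B addrAC lerDr addr_ge0 ?pabs_ge0.
  by rewrite -ltr_pdivlMr //; apply: lt_le_trans h _; rewrite ge_min lexx orbT.
apply: (@le_lt_trans _ _ (B * pabs (y - b))).
  rewrite ler_wpM2r ?pabs_ge0 //.
  have -> : a = x - (x - a) by ring.
  apply: le_trans (pabsD _ _) _; rewrite pabsN ge_max /B; apply/andP; split.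
    by rewrite -addrA lerDl addr_ge0 ?pabs_ge0.
  apply: le_trans (ltW h) _; apply: (@le_trans _ _ 1); first by rewrite ge_min lexx.
  by rewrite lerDr addr_ge0 ?pabs_ge0.
by rewrite mulrC -ltr_pdivlMr //; apply: lt_le_trans h' _; rewrite ge_min lexx orbT.
Qed.

Lemma padicQV x : padicQ x -> padicQ x^-1.
Proof.
have [->|x0] := eqVneq x 0; first by rewrite invr0.
move=> hx; apply/padicQP => e e0.
have px : 0 < pabs x by rewrite pabs_gt0.
(* The first bound forces the approximation [a] to satisfy |a| = |x|; the second absorbs the
   denominator of 1/x - 1/a = (a - x) / (x a). *)
pose d := Num.min (pabs x) (e * (pabs x * pabs x)).
have d0 : 0 < d by rewrite lt_min px !mulr_gt0.
have [m [n [n0 h]]] := (padicQP x).1 hx _ d0.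
have hm : pabs (m%:~R / n%:~R : Cp) = pabs x.
  by apply: pabs_close; rewrite pabsBC; apply: lt_le_trans h _; rewrite ge_min lexx.
have m0 : (m%:~R : Cp) != 0.
  by apply: contraTneq px => m0; rewrite -hm m0 mul0r pabs0 ltxx.
exists n, m; split; first by apply: contraNneq m0 => ->.
rewrite -invf_div; set a := _ / _ in h hm *.
have a0 : a != 0 by rewrite -pabs_gt0 hm.
have -> : x^-1 - a^-1 = (a - x) / (x * a) by field; rewrite a0.
rewrite pabsM pabsV pabsM hm ltr_pdivrMr ?mulr_gt0 // pabsBC.
by apply: lt_le_trans h _; rewrite ge_min lexx orbT.
Qed.

(** * The ring Z_p and the density of the natural numbers in it *)

Lemma padicZ_nat n : padicZ Cp n%:R.
Proof. by split; [exact: (padicQ_int n) | exact: pabs_nat_le1]. Qed.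

Lemma padicZ0 : padicZ Cp 0. Proof. exact: (padicZ_nat 0). Qed.
Lemma padicZ1 : padicZ Cp 1. Proof. exact: (padicZ_nat 1). Qed.

Lemma padicZB x y : padicZ Cp x -> padicZ Cp y -> padicZ Cp (x - y).
Proof. by move=> [? ?] [? ?]; split; [exact: padicQB | exact: pabsB_le]. Qed.

Lemma padicZN x : padicZ Cp x -> padicZ Cp (- x).
Proof. by rewrite -sub0r; apply: padicZB padicZ0. Qed.

Lemma padicZD x y : padicZ Cp x -> padicZ Cp y -> padicZ Cp (x + y).
Proof. by move=> hx hy; rewrite -(opprK y); apply: padicZB hx (padicZN hy). Qed.

Lemma padicZM x y : padicZ Cp x -> padicZ Cp y -> padicZ Cp (x * y).
Proof.
move=> [? hx] [? hy]; split; first exact: padicQM.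
by rewrite pabsM mulr_ile1 ?pabs_ge0.
Qed.

Lemma padicZV x : padicZ Cp x -> pabs x = 1 -> padicZ Cp x^-1.
Proof. by move=> [xQ _] x1; split; [exact: padicQV | rewrite pabsV x1 invr1]. Qed.

Lemma padicZX x n : padicZ Cp x -> padicZ Cp (x ^+ n).
Proof. by move=> hx; elim: n => [|n IH]; [exact: padicZ1 | rewrite exprS; apply: padicZM]. Qed.

Lemma padicZXz x (m : int) : padicZ Cp x -> pabs x = 1 -> padicZ Cp (x ^ m).
Proof.
move=> hx x1; case: m => n; first exact: padicZX.
by rewrite NegzE -exprnN -exprVn; apply: padicZX; apply: padicZV.
Qed.

Lemma pabsXz x (m : int) : pabs x = 1 -> pabs (x ^ m) = 1.
Proof.
move=> x1; case: m => n; first by rewrite pabsX x1 expr1n.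
by rewrite NegzE -exprnN -exprVn pabsX pabsV x1 invr1 expr1n.
Qed.

Lemma padicZ_sum (I : Type) (s : seq I) (P : pred I) (F : I -> Cp) :
  (forall i, P i -> padicZ Cp (F i)) -> padicZ Cp (\sum_(i <- s | P i) F i).
Proof. by move=> h; apply: (big_ind (padicZ Cp)) => //; [exact: padicZ0 | exact: padicZD]. Qed.

Lemma padicZ_prod (I : Type) (s : seq I) (P : pred I) (F : I -> Cp) :
  (forall i, P i -> padicZ Cp (F i)) -> padicZ Cp (\prod_(i <- s | P i) F i).
Proof. by move=> h; apply: (big_ind (padicZ Cp)) => //; [exact: padicZ1 | exact: padicZM]. Qed.

Lemma padicZ_lim u l : padic_cvg u l ->
  (forall n, padicZ Cp (u n)) -> padicZ Cp l.
Proof.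
move=> ul uZ; split; first by apply: padicQ_lim ul _ => n; case: (uZ n).
by apply: (abs_cvg_le (N0 := 0) ul) => n _; case: (uZ n).
Qed.

(** Q_p is closed under division, so the quotient (x - y) / a lies in Z_p exactly when its absolute
    value is at most 1. From here on congruences are handled as inequalities. *)
Lemma padicZ_eqmodP (a : nat) x y : (0 < a)%N -> padicQ (x - y) ->
  padicZ_eqmod a%:R x y <-> pabs (x - y) <= pabs (a%:R : Cp).
Proof.
move=> a0 hxy; have an := natr_neq0 a0; split.
  by case=> t [_ t1] ->; rewrite pabsM ler_piMr ?pabs_ge0.
move=> h; exists ((x - y) / a%:R); last by rewrite mulrC divfK.
split; first by apply: padicQM hxy _; apply: padicQV; apply: (padicQ_int a).
by rewrite pabsM pabsV ler_pdivrMr ?mul1r // pabs_gt0.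
Qed.

Lemma padicZ_approx_int (m : int) N :
  exists n : nat, pabs (m%:~R - n%:R : Cp) <= p%:R ^- N.
Proof.
case: m => n; first by exists n; rewrite subrr pabs0 invr_ge0 exprn_ge0 ?ler0n.
(* The negative integer -(n+1) is shifted by (n+1) p^N, which is 0 modulo p^N. *)
exists (n.+1 * (p ^ N).-1)%N; rewrite NegzE mulrNz -opprD pabsN -natrD -mulnS.
by rewrite prednK ?expn_gt0 ?prime_gt0 // pabs_dvdn // dvdn_mull.
Qed.

(** A rational number close to x has absolute value at most 1, so its reduced denominator is prime
    to p. Multiplying the numerator by an inverse of the denominator modulo p^N gives an integer in
    the same class. *)
Lemma padicZ_approx x N : padicZ Cp x ->
  exists n : nat, pabs (x - n%:R) <= p%:R ^- N.
Proof.
move=> [xQ x1]; have pN0 : 0 < (p%:R : R) ^- N by rewrite invr_gt0 exprn_gt0 ?p_gt0R.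
have pN1 : (p%:R : R) ^- N <= 1.
  by rewrite -exprVn exprn_ile1 ?invr_ge0 ?ler0n // ltW // invp_lt1.
have [_ [a _ <-] ha] := xQ _ pN0.
have a1 : pabs (ratr a : Cp) <= 1.
  rewrite -(subrK x (ratr a)); apply: pabsD_le => //.
  by rewrite pabsBC; apply: le_trans (ltW ha) pN1.
have d0 : (0 < `|denq a|)%N by rewrite absz_gt0 denq_neq0.
have dE : (denq a)%:~R = `|denq a|%:R :> Cp by rewrite -{1}absz_denq.
have aE : ratr a = (numq a)%:~R / `|denq a|%:R :> Cp by rewrite /ratr dE.
have cpd : coprime p `|denq a|.
  rewrite prime_coprime //; apply/negP => pd.
  have pn : coprime p `|numq a|.
    rewrite prime_coprime //; apply/negP => pn.
    have : (p %| gcdn `|numq a| `|denq a|)%N by rewrite dvdn_gcd pn.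
    by rewrite (eqP (coprime_num_den a)) dvdn1 => /eqP p1; move: hp; rewrite p1.
  have n1 : pabs ((numq a)%:~R : Cp) = 1.
    have := pabs_nat_coprime pn; case: (numq a) => n //.
    by rewrite NegzE mulrNz pabsN abszN.
  have : pabs (`|denq a|%:R : Cp) < 1.
    by apply: le_lt_trans invp_lt1; rewrite -(expr1 p%:R); apply: pabs_dvdn; rewrite expn1.
  apply/negP; rewrite -leNgt; move: a1; rewrite aE pabsM pabsV n1 mul1r.
  by rewrite invf_ple ?invr1 // posrE ?ltr01 // pabs_gt0 natr_neq0.
have [u v e _] := @egcdnP `|denq a| (p ^ N) d0.
have {}e : (u * `|denq a|)%:R - 1 = (v * p ^ N)%:R :> Cp.
  have /eqP g : coprime `|denq a| (p ^ N) by rewrite coprime_sym coprimeXl.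
  by rewrite e g natrD addrK.
have [n hn] := padicZ_approx_int (numq a * u%:Z) N.
exists n; apply: (@pabs_dist_le (ratr a)); first exact: ltW.
apply: pabs_dist_le hn; rewrite aE intrM.
set d := `|denq a|%:R in e *; set b := _%:~R.
have d1 : pabs (d : Cp) = 1 by apply: pabs_nat_coprime.
have -> : b / d - b * u%:R = - (b / d * (u%:R * d - 1)).
  by field; rewrite -pabs_gt0 d1.
rewrite pabsN pabsM pabsM pabsV d1 invr1 mulr1 -natrM e.
apply: le_trans (pabs_dvdn (dvdn_mull v (dvdnn _))).
by rewrite ler_piMl ?pabs_ge0 ?pabs_int_le1.
Qed.

(** * Teichmueller representatives *)

Lemma pabs_subX_le x y B n : pabs x <= B -> pabs y <= B ->
  pabs (x ^+ n.+1 - y ^+ n.+1) <= pabs (x - y) * B ^+ n.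
Proof.
move=> hx hy; have B0 : 0 <= B by apply: le_trans hx; apply: pabs_ge0.
rewrite subrXX pabsM ler_wpM2l ?pabs_ge0 //.
apply: pabs_sum_le => [|i _]; first exact: exprn_ge0.
rewrite pabsM !pabsX -[X in _ <= B ^+ X](subnK (leq_ord i)) exprD.
by apply: ler_pM; rewrite ?exprn_ge0 ?pabs_ge0 // lerXn2r // nnegrE pabs_ge0.
Qed.

Lemma modulus_gt0 : (0 < q)%N.
Proof. by rewrite /teich_modulus; case: ifP => // _; apply: prime_gt0. Qed.

Lemma pabs_modulus : pabs (q%:R : Cp) = q%:R^-1.
Proof.
rewrite /teich_modulus; case: eqP => [p2|_]; last exact: pabs_p.
have -> : 4%:R = p%:R * p%:R :> Cp by rewrite -natrM; congr _%:R; rewrite p2.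
by rewrite pabsM pabs_p -invfM -natrM p2.
Qed.

(** No element of Z_p has absolute value strictly between 1/p and 1: a natural number n within 1/p
    of x either is divisible by p, so that |x| <= 1/p, or has |n| = 1, so that |x| = 1. *)
Lemma pabs_unitP x : padicZ Cp x ->
  ~ padicZ_eqmod p%:R x 0 <-> pabs x = 1.
Proof.
move=> hx; rewrite padicZ_eqmodP ?prime_gt0 //; last by rewrite subr0; case: hx.
rewrite subr0 pabs_p; split; last first.
  by move=> ->; apply/negP; rewrite -ltNge; apply: invp_lt1.
have [n] := padicZ_approx 1 hx; rewrite expr1 => hn /negP; rewrite -ltNge => h.
have [pn|pn] := boolP (p %| n)%N.
  have : pabs x <= p%:R^-1.
    rewrite -(subrK n%:R x); apply: pabsD_le => //.
    by rewrite -(expr1 p%:R) pabs_dvdn // expn1.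
  by rewrite leNgt h.
have n1 : pabs (n%:R : Cp) = 1 by apply: pabs_nat_coprime => //; rewrite prime_coprime.
by rewrite -n1; apply: pabs_close; rewrite n1; apply: le_lt_trans hn (invp_lt1).
Qed.

Lemma teich_groupP w : teich_group w -> padicZ Cp w /\ pabs w = 1.
Proof.
rewrite /teich_group; case: eqP => _.
  by move=> [] ->; rewrite ?pabsN pabs1; split=> //;
    [|apply: padicZN]; apply: padicZ1.
by move=> [[wZ hw] _]; split=> //; apply/pabs_unitP.
Qed.

Lemma eqmod_divP x w : padicZ Cp x -> padicZ Cp w -> pabs w = 1 ->
  padicZ_eqmod q%:R (x / w) 1 <-> pabs (x - w) <= q%:R^-1.
Proof.
move=> xZ wZ w1; have w0 : w != 0 by rewrite -pabs_gt0 w1.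
have -> : x - w = (x / w - 1) * w by rewrite mulrBl mul1r divfK.
rewrite pabsM w1 mulr1 -pabs_modulus; apply: padicZ_eqmodP => //; first exact: modulus_gt0.
have [] // : padicZ Cp (x / w - 1).
by apply: padicZB padicZ1; apply: padicZM xZ _; apply: padicZV.
Qed.

(** The representative is the limit of n^(p^k). Euler's theorem, n^((p-1) p^k) = 1 modulo p^(k+1),
    gives both the convergence of this sequence and the equation w^(p-1) = 1. *)
Lemma teich_limit (n : nat) : coprime p n ->
  exists w, [/\ padicZ Cp w, pabs (w - n%:R) <= p%:R^-1 & w ^+ p.-1 = 1].
Proof.
move=> cpn; pose u k : Cp := (n ^ p ^ k)%:R.
have euler k : n ^ (p.-1 * p ^ k) = 1 %[mod p ^ k.+1].
  have -> : (p.-1 * p ^ k)%N = totient (p ^ k.+1) by rewrite totient_pfactor.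
  apply: Euler_exp_totient.
  by rewrite coprime_sym coprimeXl.
have du k : pabs (u k.+1 - u k) <= p%:R ^- k.+1.
  apply: pabs_eqmod => //.
  have -> : (n ^ p ^ k.+1 = n ^ p ^ k * n ^ (p.-1 * p ^ k))%N.
    by rewrite -expnD -mulSn prednK ?prime_gt0 // expnS.
  by rewrite -modnMmr euler modnMmr muln1.
have ip0 : 0 <= (p%:R : R)^-1 by rewrite invr_ge0.
have [w uw] : exists w, padic_cvg u w.
  apply: nonarch_cvg => e e0; have [N hN] := geometric_lt ip0 (invp_lt1) e0.
  by exists N => k Nk; apply: le_lt_trans (du k) _; rewrite -exprVn hN // ltnW // ltnS.
have wZ : padicZ Cp w by apply: padicZ_lim uw _ => k; apply: padicZ_nat.
exists w; split=> //.
  apply: (abs_cvg_dist_le (N0 := 0) uw) => k _.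
  have -> : n%:R = u 0%N by rewrite /u expn0 expn1.
  elim: k => [|k IH]; first by rewrite subrr pabs0.
  apply: pabs_dist_le IH; apply: le_trans (du k) _.
  by rewrite -exprVn exprS ler_piMr // exprn_ile1 // ltW // invp_lt1.
apply/eqP; rewrite -subr_eq0; apply/eqP/pabs_eq0/eqP; rewrite eq_le pabs_ge0 andbT.
apply/ler_addgt0Pr => e e0; rewrite add0r.
have [N1 h1] := (abs_cvgP _ _).1 uw _ e0.
have [N2 h2] := geometric_lt ip0 (invp_lt1) e0.
pose N := maxn N1 N2; apply: (@pabs_dist_le (u N ^+ p.-1)).
  have [pp|p1] := posnP p.-1; first by rewrite pp !expr0 subrr pabs0 ltW.
  rewrite -(prednK p1); apply: le_trans (pabs_subX_le _ _ _) _.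
  - by case: wZ => _; apply.
  - exact: pabs_nat_le1.
  - by rewrite expr1n mulr1 pabsBC ltW // h1 // leq_maxl.
apply: (@le_trans _ _ (p%:R ^- N.+1)).
  by rewrite -[_ ^+ p.-1]natrX; apply: (pabs_eqmod (n := 1)); rewrite -expnM mulnC.
by rewrite -exprVn ltW // h2 // leqW // leq_maxr.
Qed.

Lemma teich_exists x : padicZ Cp x -> pabs x = 1 ->
  exists w, teich_group w /\ padicZ_eqmod q%:R (x / w) 1.
Proof.
move=> xZ x1.
suff [w wT hw] : exists2 w, teich_group w & pabs (x - w) <= q%:R^-1.
  by exists w; split=> //; have [wZ w1] := teich_groupP wT; apply/eqmod_divP.
have cp N n : pabs (x - n%:R) <= p%:R ^- N.+1 -> coprime p n.
  move=> hn; rewrite prime_coprime //; apply/negP => pn.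
  have : pabs x < 1; last by rewrite x1 ltxx.
  rewrite -(subrK n%:R x); apply: le_lt_trans (invp_lt1); apply: pabsD_le.
    apply: le_trans hn _; rewrite -exprVn exprS ler_piMr ?invr_ge0 //.
    by rewrite exprn_ile1 ?invr_ge0 // ltW // invp_lt1.
  by rewrite -(expr1 p%:R) pabs_dvdn // expn1.
(* For p = 2 the group is {1, -1} and closeness is required modulo 4, so the sign is read off the
   residue of an approximation modulo 4. For odd p one has q = p, and the precision 1/p of
   [teich_limit] is the required one. *)
rewrite /teich_group /teich_modulus; case: (eqVneq p 2%N) => [p2|pn2].
  have [n hn] := padicZ_approx 2 xZ; have cpn := cp _ _ hn.
  have q4 : p%:R ^- 2 = 4%:R^-1 :> R by rewrite p2 -natrX.
  have : (n %% 4 = 1 \/ n %% 4 = 3)%N by move: cpn; rewrite p2 coprime2n; lia.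
  rewrite q4 in hn; case=> n4.
    exists 1; [by left | apply: pabs_dist_le hn _].
    by rewrite -q4; apply: (pabs_eqmod (n := 1)); rewrite p2.
  exists (-1); [by right | apply: pabs_dist_le hn _].
  by rewrite opprK natr1 -q4; apply: pabs_dvdn => //; rewrite p2; lia.
have [n hn] := padicZ_approx 1 xZ; have cpn := cp _ _ hn.
have [w [wZ wn w1]] := teich_limit cpn.
exists w; last by apply: pabs_dist_le hn _; rewrite pabsBC.
split=> //; split=> //; apply/pabs_unitP => //.
apply/eqP; rewrite -(@pexpr_eq1 _ _ p.-1) ?pabs_ge0 //.
  by rewrite -pabsX w1 pabs1.
by have := prime_gt1 hp; case: (p) => [|[]].
Qed.

Lemma teichP x : padicZ Cp x -> pabs x = 1 ->
  [/\ padicZ Cp (teich x), pabs (teich x) = 1 & pabs (x - teich x) <= q%:R^-1].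
Proof.
move=> xZ x1; have [wT hw] := xgetPex 0 (teich_exists xZ x1).
by have [wZ w1] := teich_groupP wT; split=> //; apply/eqmod_divP.
Qed.

(** Points within 1/q of each other have the same set of candidate representatives, and [xget]
    depends only on that set. *)
Lemma teich_locally_constant x y : padicZ Cp x -> padicZ Cp y ->
  pabs (x - y) <= q%:R^-1 -> teich x = teich y.
Proof.
move=> xZ yZ xy; congr (xget 0 _); apply/seteqP.
by split=> w [wT hw]; split=> //; have [wZ w1] := teich_groupP wT;
  move: hw; rewrite !eqmod_divP // => hw; apply: pabs_dist_le hw; rewrite // pabsBC.
Qed.

Lemma diamondP x : padicZ Cp x -> pabs x = 1 ->
  padicZ Cp (diamond x) /\ pabs (diamond x - 1) <= q%:R^-1.
Proof.
move=> xZ x1; have [wZ w1 hw] := teichP xZ x1.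
split; first by apply: padicZM xZ _; apply: padicZV.
have w0 : teich x != 0 by rewrite -pabs_gt0 w1.
have -> : diamond x - 1 = (x - teich x) / teich x by rewrite mulrBl divff.
by rewrite pabsM pabsV w1 invr1 mulr1.
Qed.

Lemma diamond_isometry x y : padicZ Cp x -> padicZ Cp y -> pabs x = 1 ->
  pabs (x - y) <= q%:R^-1 -> pabs (diamond x - diamond y) = pabs (x - y).
Proof.
move=> xZ yZ x1 xy; have [wZ w1 _] := teichP xZ x1.
rewrite /diamond -(teich_locally_constant xZ yZ xy) -mulrBl pabsM pabsV w1.
by rewrite invr1 mulr1.
Qed.

(** * Power series and binomial coefficients *)

Lemma abs_cvgB u v l l' : padic_cvg u l ->
  padic_cvg v l' -> padic_cvg (fun n => u n - v n) (l - l').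
Proof.
move=> /abs_cvgP ul /abs_cvgP vl; apply/abs_cvgP => e e0.
have [N1 h1] := ul _ e0; have [N2 h2] := vl _ e0; exists (maxn N1 N2) => n.
rewrite geq_max => /andP[/h1 hu /h2 hv].
have -> : u n - v n - (l - l') = u n - l - (v n - l') by ring.
by apply: pabsD_lt; rewrite ?pabsN.
Qed.

Lemma abs_cvg_cst l : padic_cvg (fun=> l) l.
Proof. by apply/abs_cvgP => e e0; exists 0%N => n _; rewrite subrr pabs0. Qed.

Lemma abs_cvgD u v l l' : padic_cvg u l ->
  padic_cvg v l' -> padic_cvg (fun n => u n + v n) (l + l').
Proof.
move=> ul vl; have := abs_cvgB ul (abs_cvgB (abs_cvg_cst 0) vl).
by under eq_fun do rewrite sub0r opprK; rewrite sub0r opprK.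
Qed.

Lemma abs_cvgMr u l x : padic_cvg u l ->
  padic_cvg (fun n => u n * x) (l * x).
Proof.
have [->|x0] := eqVneq x 0.
  by under eq_fun do rewrite mulr0; rewrite mulr0 => _; apply: abs_cvg_cst.
move=> /abs_cvgP ul; apply/abs_cvgP => e e0.
have px : 0 < pabs x by rewrite pabs_gt0.
have [N h] := ul _ (divr_gt0 e0 px); exists N => n /h.
by rewrite -mulrBl pabsM ltr_pdivlMr.
Qed.

Lemma abs_cvg_sum (I : Type) (s : seq I) (F : I -> nat -> Cp) (L : I -> Cp) :
  (forall i, padic_cvg (F i) (L i)) ->
  padic_cvg (fun n => \sum_(i <- s) F i n) (\sum_(i <- s) L i).
Proof.
move=> h; elim: s => [|i s IH].
  by under eq_fun do rewrite big_nil; rewrite big_nil; apply: abs_cvg_cst.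
by under eq_fun do rewrite big_cons; rewrite big_cons; apply: abs_cvgD.
Qed.

(** * Growth of 1/n! and the radius *)

Lemma logn_fact_le n : (p.-1 * logn p n`! <= n)%N.
Proof.
rewrite logn_fact //.
(* Legendre's sum is truncated at K and the remainder n / p^K is kept, so that each step only uses p
   (n / p^(K+1)) <= n / p^K for integer quotients. *)
have step K : (p.-1 * (\sum_(1 <= k < K.+1) n %/ p ^ k) + n %/ p ^ K <= n)%N.
  elim: K => [|K IH]; first by rewrite big_geq // muln0 expn0 divn1.
  apply: leq_trans IH; rewrite big_nat_recr //= mulnDr -addnA leq_add2l.
  rewrite -mulSnr prednK ?prime_gt0 // expnSr divnMA mulnC.
  exact: leq_divM.
exact: leq_trans (leq_addr _ _) (step n).
Qed.

Local Notation lam := (p%:R `^ (p.-1%:R)^-1 : R).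
Local Notation rho := (padic_radius R p).

Lemma pred_prime_gt0 : (0 < p.-1)%N.
Proof. by have := prime_gt1 hp; case: (p) => [|[]]. Qed.

Lemma lamX : lam ^+ p.-1 = p%:R.
Proof.
rewrite -powR_mulrn ?powR_ge0 // -powRrM mulVf ?powRr1 ?ler0n //.
by rewrite pnatr_eq0 -lt0n pred_prime_gt0.
Qed.

Lemma lam_gt0 : 0 < lam. Proof. by rewrite powR_gt0 // p_gt0R. Qed.

Lemma lam_ge1 : 1 <= lam.
Proof.
rewrite leNgt; apply/negP => /ltW h.
have : lam ^+ p.-1 <= 1 by rewrite exprn_ile1 // ltW // lam_gt0.
by rewrite lamX lern1 leqNgt prime_gt1.
Qed.

Lemma radiusE : rho = q%:R / lam.
Proof. by rewrite /padic_radius powRN. Qed.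

(** Raising [lam] < q to the power p - 1 gives p < q^(p-1), which reads 2 < 4 for p = 2 and p <
    p^(p-1) for odd p. *)
Lemma radius_gt1 : 1 < rho.
Proof.
rewrite radiusE ltr_pdivlMr ?lam_gt0 // mul1r.
rewrite -(@ltr_pXn2r _ p.-1) ?nnegrE ?ler0n ?(ltW lam_gt0) ?pred_prime_gt0 //.
rewrite lamX -natrX ltr_nat /teich_modulus; case: eqP => [->//|p2].
have := prime_gt1 hp; case: p p2 => [|[|[|n]]] //= _ _.
by rewrite -{1}(expn1 n.+3) ltn_exp2l.
Qed.

Lemma radius_gt0 : 0 < rho. Proof. exact: lt_trans ltr01 radius_gt1. Qed.

(** With v the valuation of n!, the left side is p^v = [lam]^((p-1) v), and (p-1) v <= n. *)
Lemma pabs_fact_le n : (pabs (n`!%:R : Cp))^-1 <= lam ^+ n.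
Proof.
rewrite pabs_natE ?fact_gt0 // invrK -[X in X ^+ logn _ _]lamX -exprM.
by apply: ler_weXn2l; [exact: lam_ge1 | exact: logn_fact_le].
Qed.

Lemma pabs_fact_radius n : (pabs (n`!%:R : Cp))^-1 * q%:R ^- n <= rho ^- n.
Proof.
by rewrite radiusE expr_div_n invf_div ler_wpM2r ?pabs_fact_le.
Qed.

Section PowerSeries.
Variables (a : nat -> Cp) (t : R).
Hypotheses (t0 : 0 <= t) (t1 : t < 1).
Hypothesis at_le : forall n, pabs (a n) * q%:R ^- n <= t ^+ n.

Definition pseries x := padic_lim (fun N => \sum_(n < N) a n * x ^+ n).

Lemma pseries_term_le x n B : pabs (a n) * q%:R ^- n <= B ->
  pabs x <= q%:R^-1 -> pabs (a n * x ^+ n) <= B.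
Proof.
move=> h hx; apply: le_trans h; rewrite pabsM pabsX ler_wpM2l ?pabs_ge0 //.
by rewrite -exprVn lerXn2r // nnegrE ?pabs_ge0 // invr_ge0 ler0n.
Qed.

Lemma pseries_cvg x : pabs x <= q%:R^-1 ->
  padic_cvg (fun N => \sum_(n < N) a n * x ^+ n) (pseries x).
Proof.
move=> hx; rewrite /pseries.
have [l ul] : exists l, padic_cvg (fun N => \sum_(n < N) a n * x ^+ n) l.
  apply: nonarch_cvg => e e0; have [N hN] := geometric_lt t0 t1 e0.
  exists N => n /hN; apply: le_lt_trans; rewrite big_ord_recr /= addrAC subrr add0r.
  exact: pseries_term_le.
by rewrite (padic_limE ul).
Qed.

Lemma pseries_le x B : pabs x <= q%:R^-1 ->
  (forall n, pabs (a n) * q%:R ^- n <= B) -> pabs (pseries x) <= B.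
Proof.
move=> hx hB; apply: (abs_cvg_le (N0 := 0) (pseries_cvg hx)) => N _.
have B0 : 0 <= B.
  by apply: le_trans (hB 0%N); rewrite mulr_ge0 ?pabs_ge0 // invr_ge0 exprn_ge0 ?ler0n.
by apply: pabs_sum_le => // n _; apply: pseries_term_le.
Qed.

Lemma pseries_padicZ x : pabs x <= q%:R^-1 ->
  (forall n, padicZ Cp (a n * x ^+ n)) -> padicZ Cp (pseries x).
Proof.
move=> hx h; apply: (padicZ_lim (pseries_cvg hx)) => N.
by apply: padicZ_sum => n _.
Qed.

(** Factoring x - y out of x^(n+1) - y^(n+1) leaves |a_(n+1)| q^(-n), one factor of q short of the
    quantity bounded by [at_le]; this is the Lipschitz constant. *)
Lemma pseries_lipschitz x y : pabs x <= q%:R^-1 -> pabs y <= q%:R^-1 ->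
  pabs (pseries x - pseries y) <= q%:R * pabs (x - y).
Proof.
move=> hx hy; have C0 : 0 <= q%:R * pabs (x - y) by rewrite mulr_ge0 ?pabs_ge0 ?ler0n.
apply: (abs_cvg_le (N0 := 0) (abs_cvgB (pseries_cvg hx) (pseries_cvg hy))) => N _.
rewrite -sumrB; apply: pabs_sum_le => // -[n _] _ /=; rewrite -mulrBr pabsM.
case: n => [|n]; first by rewrite !expr0 subrr pabs0 mulr0.
apply: (@le_trans _ _ (pabs (a n.+1) * (pabs (x - y) * q%:R^-1 ^+ n))).
  by rewrite ler_wpM2l ?pabs_ge0 //; apply: pabs_subX_le.
have -> : pabs (a n.+1) * (pabs (x - y) * q%:R^-1 ^+ n)
        = q%:R * pabs (x - y) * (pabs (a n.+1) * q%:R ^- n.+1).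
  rewrite -exprVn exprS; field.
  by rewrite pnatr_eq0 -lt0n modulus_gt0.
rewrite ler_piMr //; apply: le_trans (at_le _) _.
by rewrite exprn_ile1 // ltW.
Qed.

End PowerSeries.

(** This is n! times the binomial coefficient (-X choose n). It is taken over the integers so that
    its coefficients have absolute value at most 1 in [Cp]. *)
Definition binom_poly n : {poly int} := \prod_(i < n) (- 'X - i%:R%:P).

(* The coefficient of [s ^ m] in the binomial coefficient [(-s choose n)]. *)
Definition binom_coef (m n : nat) : Cp := ((binom_poly n)`_m)%:~R / n`!%:R.

Lemma size_binom_poly n : (size (binom_poly n) <= n.+1)%N.
Proof.
rewrite /binom_poly; elim: n => [|n IH]; first by rewrite big_ord0 size_poly1.
rewrite big_ord_recr /=; apply: leq_trans (size_polyMleq _ _) _.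
have -> : - 'X - n%:R%:P = - ('X + n%:R%:P) :> {poly int} by rewrite opprD.
by rewrite size_polyN size_XaddC addn2.
Qed.

Lemma binom_coef_eq0 m n : (n < m)%N -> binom_coef m n = 0.
Proof.
move=> nm; rewrite /binom_coef nth_default ?mul0r //.
exact: leq_trans (size_binom_poly n) nm.
Qed.

(** The length [K] is free above n, so that all n below a bound can share one range of m when the
    two sums are exchanged. *)
Lemma gbinomN (s : Cp) n K : (n < K)%N ->
  gbinom (- s) n = \sum_(m < K) binom_coef m n * s ^+ m.
Proof.
move=> nK; rewrite /gbinom /binom_coef.
under [RHS]eq_bigr do rewrite mulrAC; rewrite -mulr_suml; congr (_ / _).
pose P := map_poly intr (binom_poly n) : {poly Cp}.
transitivity P.[s].
  rewrite /P /binom_poly rmorph_prod horner_prod; apply: eq_bigr => i _.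
  by rewrite rmorphB rmorphN /= map_polyX map_polyC /= !hornerE rmorph_nat.
rewrite (@horner_coef_wide _ K).
  by apply: eq_bigr => m _; rewrite coef_map.
by apply: leq_trans (size_poly _ _) _; apply: leq_trans (size_binom_poly n) _.
Qed.

Lemma binom_coef_le m n : pabs (binom_coef m n) <= (pabs (n`!%:R : Cp))^-1.
Proof. by rewrite pabsM pabsV ler_piMl ?invr_ge0 ?pabs_ge0 ?pabs_int_le1. Qed.

Lemma binom_coef_radius m n : pabs (binom_coef m n) * q%:R ^- n <= rho ^- n.
Proof.
by apply: le_trans (pabs_fact_radius n); rewrite ler_wpM2r ?binom_coef_le.
Qed.

Lemma radiusV_lt1 : 0 <= rho^-1 < 1.
Proof. by rewrite invr_ge0 (ltW radius_gt0) invf_lt1 ?radius_gt0 // radius_gt1. Qed.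

(** Terms with n < m vanish and for n >= m the bound rho^(-n) is at most rho^(-m), as rho > 1.
    Uniformity in n is what yields the final estimate on the coefficients. *)
Lemma binom_coef_radius_le m n : pabs (binom_coef m n) * q%:R ^- n <= rho ^- m.
Proof.
have /andP[r0 r1] := radiusV_lt1.
have [mn|nm] := leqP m n; last first.
  by rewrite binom_coef_eq0 // pabs0 mul0r -exprVn exprn_ge0.
by apply: le_trans (binom_coef_radius m n) _; rewrite -!exprVn ler_wiXn2l // ltW.
Qed.

(* The coefficient of [s ^ m] in [(1 + x) ^ (- s)]. *)
Definition pow_coef m : Cp -> Cp := pseries (binom_coef m).

Lemma pow_coef_le m x : pabs x <= q%:R^-1 -> pabs (pow_coef m x) <= rho ^- m.
Proof.
move=> hx; have /andP[r0 r1] := radiusV_lt1.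
apply: (pseries_le r0 r1) => // n; rewrite ?exprVn.
  exact: binom_coef_radius.
exact: binom_coef_radius_le.
Qed.

Lemma pow_coef_padicZ m x : padicZ Cp x -> pabs x <= q%:R^-1 -> padicZ Cp (pow_coef m x).
Proof.
move=> xZ hx; have /andP[r0 r1] := radiusV_lt1.
have bc n : pabs (binom_coef m n) * q%:R ^- n <= rho^-1 ^+ n.
  by rewrite exprVn binom_coef_radius.
apply: (pseries_padicZ r0 r1 bc hx) => n; split.
  apply: padicQM; last by case: (padicZX n xZ).
  by apply: padicQM; [exact: padicQ_int | apply/padicQV/(padicQ_int n`!)].
apply: le_trans (pseries_term_le (bc n) hx) _.
by rewrite exprn_ile1 // ltW.
Qed.

Lemma pow_coef_lipschitz m x y : pabs x <= q%:R^-1 -> pabs y <= q%:R^-1 ->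
  pabs (pow_coef m x - pow_coef m y) <= q%:R * pabs (x - y).
Proof.
have /andP[r0 r1] := radiusV_lt1; apply: (pseries_lipschitz r0 r1) => n.
by rewrite exprVn binom_coef_radius.
Qed.

(** * The power with exponent -s as a series in s *)

Section Exponent.
Variables (s : Cp) (hs : pabs s < rho).

Local Notation theta := (Num.max 1 (pabs s) / rho).

Lemma exponent_ratio : 0 <= theta < 1.
Proof.
rewrite divr_ge0 ?(ltW radius_gt0) ?le_max ?ler01 //=.
by rewrite ltr_pdivrMr ?radius_gt0 // mul1r gt_max radius_gt1.
Qed.

(** The maximum with 1 in [theta] gives |s|^m <= max(1, |s|)^n for every m <= n, hence a bound
    independent of m even when |s| < 1. *)
Lemma binom_term_le m n : (m <= n)%N ->
  pabs (binom_coef m n * s ^+ m) * q%:R ^- n <= theta ^+ n.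
Proof.
move=> mn; rewrite pabsM pabsX mulrAC expr_div_n mulrC.
apply: ler_pM; rewrite ?exprn_ge0 ?pabs_ge0 ?mulr_ge0 ?invr_ge0 ?exprn_ge0 ?ler0n
  ?binom_coef_radius ?pabs_ge0 //.
apply: (@le_trans _ _ (Num.max 1 (pabs s) ^+ m)).
  by apply: lerXn2r; rewrite ?nnegrE ?pabs_ge0 // ?le_max ?ler01 ?lexx ?orbT.
by rewrite ler_weXn2l // le_max lexx.
Qed.

Lemma gbinom_le n : pabs (gbinom (- s) n) * q%:R ^- n <= theta ^+ n.
Proof.
have /andP[r0 r1] := exponent_ratio.
have qn : 0 < (q%:R : R) ^+ n by rewrite exprn_gt0 // ltr0n modulus_gt0.
rewrite (gbinomN s (ltnSn n)) ler_pdivrMr //; apply: pabs_sum_le.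
  by rewrite mulr_ge0 ?exprn_ge0 ?ler0n.
by move=> [m hm] _; rewrite -ler_pdivrMr //; apply: binom_term_le.
Qed.

Lemma pow_lipschitz x y : pabs x <= q%:R^-1 -> pabs y <= q%:R^-1 ->
  pabs (pseries (gbinom (- s)) x - pseries (gbinom (- s)) y) <= q%:R * pabs (x - y).
Proof.
have /andP[r0 r1] := exponent_ratio; apply: (pseries_lipschitz r0 r1) => n.
exact: gbinom_le.
Qed.

Lemma pow_le1 x : pabs x <= q%:R^-1 -> pabs (pseries (gbinom (- s)) x) <= 1.
Proof.
move=> hx; have /andP[r0 r1] := exponent_ratio.
apply: (pseries_le r0 r1) => // n; first exact: gbinom_le.
by apply: le_trans (gbinom_le n) _; rewrite exprn_ile1 // ltW.
Qed.

Lemma pow_coef_term_le m x : pabs x <= q%:R^-1 ->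
  pabs (pow_coef m x * s ^+ m) <= theta ^+ m.
Proof.
move=> hx; rewrite pabsM pabsX expr_div_n mulrC; apply: ler_pM.
- by rewrite exprn_ge0 ?pabs_ge0.
- exact: pabs_ge0.
- by apply: lerXn2r; rewrite ?nnegrE ?pabs_ge0 // ?le_max ?ler01 ?lexx ?orbT.
- exact: pow_coef_le.
Qed.

(* Interchange of the sums over [n] and [m] in
   [(1 + x) ^ (- s) = \sum_n \sum_(m <= n) binom_coef m n * s ^ m * x ^ n]. *)
Lemma pow_expansion x M : pabs x <= q%:R^-1 ->
  pabs (\sum_(m < M) pow_coef m x * s ^+ m - pseries (gbinom (- s)) x) <= theta ^+ M.
Proof.
move=> hx; have /andP[t0 t1] := exponent_ratio; have /andP[r0 r1] := radiusV_lt1.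
have cA m : padic_cvg
    (fun N => (\sum_(n < N) binom_coef m n * x ^+ n) * s ^+ m) (pow_coef m x * s ^+ m).
  apply: abs_cvgMr; apply: (pseries_cvg r0 r1) => // n.
  by rewrite exprVn binom_coef_radius.
have cG := pseries_cvg t0 t1 gbinom_le hx.
apply: (abs_cvg_le (N0 := 0) (abs_cvgB (abs_cvg_sum _ (fun m : 'I_M => cA m)) cG)) => N _.
(* The range M + N covers every n < N and contains the M exponents of the truncation, which cancel
   exactly. In what remains the exponent of s is at least M, so only terms with n >= M survive, each
   at most theta^n <= theta^M. *)
have -> : \sum_(n < N) gbinom (- s) n * x ^+ n =
    \sum_(m < M + N) \sum_(n < N) binom_coef m n * x ^+ n * s ^+ m.
  rewrite exchange_big; apply: eq_bigr => -[n nN] _ /=.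
  rewrite (@gbinomN s n (M + N)) ?mulr_suml; last exact: ltn_addl.
  by apply: eq_bigr => m _; rewrite mulrAC.
rewrite big_split_ord /= opprD addrA.
have -> : \sum_(m < M) (\sum_(n < N) binom_coef m n * x ^+ n) * s ^+ m
   = \sum_(m < M) \sum_(n < N) binom_coef m n * x ^+ n * s ^+ m.
  by apply: eq_bigr => m _; rewrite mulr_suml.
rewrite subrr sub0r pabsN.
apply: pabs_sum_le => [|j _]; first exact: exprn_ge0.
apply: pabs_sum_le => [|n _]; first exact: exprn_ge0.
have [jn|nj] := leqP (M + j) n; last by rewrite binom_coef_eq0 // !mul0r pabs0 exprn_ge0.
rewrite mulrAC; apply: (@le_trans _ _ (theta ^+ n)).
  rewrite pabsM pabsX.
  apply: le_trans (binom_term_le jn); rewrite ler_wpM2l ?pabs_ge0 //.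
  by rewrite -exprVn lerXn2r // nnegrE ?pabs_ge0 // invr_ge0 ler0n.
by rewrite ler_wiXn2l // ?(ltW t1) // (leq_trans (leq_addr j M)).
Qed.

End Exponent.

(** * The measure *)

Section Measure.
Variables (c : nat) (hc1 : (1 < c)%N) (hcp : coprime c p).

Lemma unity_root_coprime x n : x ^+ c = 1 -> coprime c n -> x ^+ n = 1 -> x = 1.
Proof.
move=> xc /eqP cn xn; have [km kn e _] := @egcdnP c n (ltnW hc1).
have : x ^+ (km * c) = x ^+ (kn * n + 1) by rewrite e cn.
by rewrite mulnC exprM xc expr1n addn1 exprS mulnC exprM xn expr1n mulr1 => <-.
Qed.

Lemma geometric_sum_root x : x ^+ c = 1 -> x != 1 -> \sum_(k < c) x ^+ k = 0.
Proof.
move=> xc x1; apply/eqP; have := subrX1 x c; rewrite xc subrr => /esym/eqP.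
by rewrite mulf_eq0 subr_eq0 (negPf x1).
Qed.

Lemma inv_1sub_root x : x ^+ c = 1 -> x != 1 ->
  (1 - x)^-1 = - c%:R^-1 * \sum_(k < c) k%:R * x ^+ k.
Proof.
move=> xc x1; have c0 : (c%:R : Cp) != 0 by rewrite natr_neq0 // ltnW.
have x0 : 1 - x != 0 by rewrite subr_eq0 eq_sym.
(* Summation by parts; at n = c the geometric sum vanishes and only -c is left. *)
have key n : (1 - x) * \sum_(k < n) k%:R * x ^+ k = x * \sum_(k < n) x ^+ k - n%:R * x ^+ n.
  elim: n => [|n IH]; first by rewrite !big_ord0 !mulr0 mul0r subrr.
  by rewrite !big_ord_recr /= !mulrDr IH -natr1 exprS; ring.
have := key c; rewrite geometric_sum_root // xc mulr0 sub0r mulr1 => e.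
by apply: (mulfI x0); rewrite divff // mulrCA e mulrNN mulVf.
Qed.

Lemma prim_root_exists : exists z : Cp, c.-primitive_root z.
Proof.
pose P : {poly Cp} := 'X^c - 1; have [r DP] := closed_field_poly_normal P.
have c0 : (0 < c)%N by apply: ltnW.
rewrite (monicP _) ?monicXnsubC // scale1r in DP.
have rn1 : all c.-unity_root r by apply/allP=> z; rewrite -root_prod_XsubC -DP.
have sz_r : (c < (size r).+1)%N.
  by rewrite -(size_prod_XsubC r id) -DP size_XnsubC.
have [|z] := hasP (has_prim_root c0 rn1 _ sz_r); last by exists z.
by rewrite -separable_prod_XsubC -DP cyclotomic.separable_Xn_sub_1 // natr_neq0.
Qed.

(** Enumerating the nontrivial roots as powers of a primitive one replaces the sum over a set by an
    indexed sum, which can be exchanged with other finite sums. *)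
Lemma sum_unity_roots z (F : Cp -> Cp) : c.-primitive_root z ->
  \sum_(xi \in [set xi : Cp | xi ^+ c = 1 /\ xi != 1]%classic) F xi =
  \sum_(1 <= i < c) F (z ^+ i).
Proof.
move=> zP; have zi i : (z ^+ i == 1) = (c %| i)%N.
  by rewrite -(expr0 z) (eq_prim_root_expr zP) mod0n.
have -> : [set xi : Cp | xi ^+ c = 1 /\ xi != 1]%classic
    = [set` [seq z ^+ i | i <- index_iota 1 c]]%classic.
  apply/seteqP; split=> x /=.
    move=> [xc x1]; have [i xE] := prim_rootP zP xc.
    apply/mapP; exists (i : nat) => //; rewrite mem_index_iota ltn_ord andbT lt0n.
    by apply: contraNneq x1 => i0; rewrite xE i0.
  move=> /mapP[i]; rewrite mem_index_iota => /andP[i0 ic] ->.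
  by rewrite exprAC (prim_expr_order zP) expr1n zi gtnNdvd.
rewrite -fsbig_seq ?big_map // map_inj_in_uniq ?iota_uniq // => i j.
rewrite !mem_index_iota => /andP[_ ic] /andP[_ jc] /eqP.
by rewrite (eq_prim_root_expr zP) !modn_small // => /eqP.
Qed.

(** For a nontrivial c-th root xi, xi^(p^N) is again one because p is prime to c, so its inverse of
    1 - x can be expanded. Summing over xi leaves 1/c times an integer combination of power sums of
    the nontrivial roots, each equal to c - 1 or -1. *)
Lemma mtilde_padicZ N j : padicZ Cp (mtilde Cp c N j).
Proof.
have [z zP] := prim_root_exists; rewrite /mtilde (sum_unity_roots _ zP).
have zi i : (z ^+ i == 1) = (c %| i)%N.
  by rewrite -(expr0 z) (eq_prim_root_expr zP) mod0n.
have zc i : (z ^+ i) ^+ c = 1 by rewrite exprAC (prim_expr_order zP) expr1n.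
have c0 : (0 < c)%N by apply: ltnW.
have cV : padicZ Cp c%:R^-1.
  by apply: padicZV; [exact: padicZ_nat | rewrite pabs_nat_coprime // coprime_sym].
have power_sum m : padicZ Cp (\sum_(1 <= i < c) (z ^+ i) ^+ m).
  have -> : \sum_(1 <= i < c) (z ^+ i) ^+ m = \sum_(i < c) (z ^+ m) ^+ i - 1.
    rewrite -(big_mkord xpredT (fun i => (z ^+ m) ^+ i)) [in RHS]big_ltn // expr0 addrC addKr.
    by apply: eq_bigr => i _; rewrite exprAC.
  apply: padicZB padicZ1; have [->|zm] := eqVneq (z ^+ m) 1.
    by apply: padicZ_sum => i _; rewrite expr1n; apply: padicZ1.
  by rewrite geometric_sum_root //; apply: padicZ0.
have -> : \sum_(1 <= i < c) koblitz_measure (z ^+ i) N j =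
    - c%:R^-1 * \sum_(k < c) k%:R * \sum_(1 <= i < c) (z ^+ i) ^+ (j + p ^ N * k).
  under [in RHS]eq_bigr do rewrite mulr_sumr.
  rewrite exchange_big mulr_sumr; apply: eq_big_nat => i /andP[i0 ic].
  rewrite /koblitz_measure inv_1sub_root.
  - rewrite mulrCA mulr_sumr; congr (_ * _); apply: eq_bigr => k _.
    by rewrite mulrCA exprD [_ ^+ (p ^ N * k)]exprM.
  - by rewrite exprAC zc expr1n.
  - by rewrite -exprM zi Gauss_dvdl ?coprimeXr // gtnNdvd.
apply: padicZM; first exact: padicZN.
by apply: padicZ_sum => k _; apply: padicZM; [exact: padicZ_nat | exact: power_sum].
Qed.

(** The classes above j are j + i p^N with i < p, and the sum over i of x^(i p^N) is the geometric
    quotient (1 - x^(p^(N+1))) / (1 - x^(p^N)). *)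
Lemma koblitz_additive x N j : x ^+ (p ^ N.+1) != 1 -> (j < p ^ N)%N ->
  koblitz_measure x N j =
  \sum_(a < (p ^ N.+1)%N | (a %% p ^ N == j)%N) koblitz_measure x N.+1 a.
Proof.
move=> xn jN; rewrite /koblitz_measure; set M := (p ^ N)%N.
have M0 : (0 < M)%N by rewrite expn_gt0 prime_gt0.
have ME : (p ^ N.+1 = p * M)%N by rewrite expnS.
have h1 (i : 'I_p) : (j + i * M < p ^ N.+1)%N.
  by rewrite ME (leq_trans (n := i.+1 * M)) ?leq_mul2r ?ltn_ord ?orbT // mulSn ltn_add2r.
have h2 (b : 'I_(p ^ N.+1)) : (b %/ M < p)%N by rewrite ltn_divLR // -ME.
rewrite (reindex_onto (fun i => Ordinal (h1 i)) (fun b => Ordinal (h2 b))) /=; last first.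
  by move=> b /eqP bj; apply: val_inj; rewrite /= -bj addnC -divn_eq.
rewrite (eq_bigl xpredT) => [|i]; last first.
  apply/andP; split; first by rewrite addnC modnMDl modn_small.
  by apply/eqP/val_inj; rewrite /= addnC divnMDl // divn_small // addn0.
rewrite -mulr_suml; under eq_bigr do rewrite exprD mulnC exprM.
rewrite -mulr_sumr -mulrA; congr (_ * _).
have x1 : 1 - x ^+ M != 0.
  rewrite subr_eq0 eq_sym; apply: contraNneq xn => e.
  by rewrite ME mulnC exprM e expr1n.
have xn0 : 1 - x ^+ (p ^ N.+1) != 0 by rewrite subr_eq0 eq_sym.
apply: (mulIf xn0); rewrite divfK // ME mulnC exprM.
rewrite -(opprB (_ ^+ p)) subrX1 -mulNr opprB mulrA mulVf // mul1r.
by [].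
Qed.

Lemma mtilde_additive N j : (j < p ^ N)%N ->
  mtilde Cp c N j = \sum_(a < (p ^ N.+1)%N | (a %% p ^ N == j)%N) mtilde Cp c N.+1 a.
Proof.
move=> jN; have [z zP] := prim_root_exists.
rewrite /mtilde (sum_unity_roots _ zP).
under [in RHS]eq_bigr do rewrite (sum_unity_roots _ zP).
rewrite exchange_big; apply: eq_big_nat => i /andP[i0 ic]; apply: koblitz_additive => //.
have zc : (z ^+ i) ^+ c = 1 by rewrite exprAC (prim_expr_order zP) expr1n.
apply/eqP => /(unity_root_coprime zc); rewrite coprimeXr // => /(_ isT) /eqP.
by rewrite -(expr0 z) (eq_prim_root_expr zP) mod0n; apply/negP; rewrite -/(_ %| _)%N gtnNdvd.
Qed.

End Measure.

(** * Integration *)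

Lemma pabs_sum_lt (I : Type) (s : seq I) (P : pred I) (F : I -> Cp) B :
  0 < B -> (forall i, P i -> pabs (F i) < B) ->
  pabs (\sum_(i <- s | P i) F i) < B.
Proof.
move=> B0 h; apply: (big_ind (fun x => pabs x < B)) => //; first by rewrite pabs0.
by move=> x y; apply: pabsD_lt.
Qed.

Section RiemannIntegral.
Variables (r : nat) (m : ball_measure Cp).
Hypothesis mZ : forall N j, padicZ Cp (m N j).
Hypothesis m_additive : forall N j, (j < p ^ N)%N ->
  m N j = \sum_(a < (p ^ N.+1)%N | (a %% p ^ N == j)%N) m N.+1 a.
Implicit Types (f g : ('I_r -> Cp) -> Cp).

Definition unif_continuous g := forall e, 0 < e -> exists N : nat,
  forall x y : 'I_r -> Cp, (forall i, padicZ Cp (x i)) -> (forall i, padicZ Cp (y i)) ->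
    (forall i, pabs (x i - y i) <= p%:R ^- N) -> pabs (g x - g y) < e.

Definition center N (j : {ffun 'I_r -> 'I_(p ^ N)}) : 'I_r -> Cp :=
  fun i => (j i)%:R.

Definition center_sum g N :=
  \sum_(j : {ffun 'I_r -> 'I_(p ^ N)}) g (center j) * \prod_(i < r) m N (j i).

Lemma pabs_pX N : pabs ((p ^ N)%:R : Cp) = p%:R ^- N.
Proof. by rewrite natrX pabsX pabs_p exprVn. Qed.

Lemma center_padicZ N (j : {ffun 'I_r -> 'I_(p ^ N)}) i : padicZ Cp (center j i).
Proof. exact: padicZ_nat. Qed.

Lemma center_tag N : ball_tag (@center N).
Proof.
move=> j i; split; first exact: padicZ_nat.
by exists 0; [exact: padicZ0 | rewrite subrr mulr0].
Qed.

Lemma ball_tag_close N (t : {ffun 'I_r -> 'I_(p ^ N)} -> 'I_r -> Cp) j i :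
  ball_tag t -> pabs (t j i - center j i) <= p%:R ^- N.
Proof.
by move=> /(_ j i) [_ [y [_ y1] ->]]; rewrite pabsM pabs_pX ler_piMr ?invr_ge0 ?exprn_ge0.
Qed.

Lemma pabs_prod_measure_le1 N (j : 'I_r -> nat) : pabs (\prod_(i < r) m N (j i)) <= 1.
Proof. by have [] : padicZ Cp (\prod_(i < r) m N (j i)) by apply: padicZ_prod. Qed.

Lemma riemann_dist_lt N (F G : {ffun 'I_r -> 'I_(p ^ N)} -> Cp) e : 0 < e ->
  (forall j, pabs (F j - G j) < e) ->
  pabs (\sum_j F j * \prod_(i < r) m N (j i) - \sum_j G j * \prod_(i < r) m N (j i)) < e.
Proof.
move=> e0 h; rewrite -sumrB; apply: pabs_sum_lt => // j _.
rewrite -mulrBl pabsM; apply: le_lt_trans (h j).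
by rewrite ler_piMr ?pabs_ge0 // (pabs_prod_measure_le1 N (fun i => j i)).
Qed.

Lemma ltn_modp N (a : nat) : (a %% p ^ N < p ^ N)%N.
Proof. by rewrite ltn_mod expn_gt0 prime_gt0. Qed.

Definition reduce N (j : {ffun 'I_r -> 'I_(p ^ N.+1)}) : {ffun 'I_r -> 'I_(p ^ N)} :=
  [ffun i => Ordinal (ltn_modp N (j i))].

(** Expanding the product of the one-variable additivity relations gives additivity of the product
    measure over the fibres of [reduce]. Riemann sums at consecutive levels can then be compared on
    one partition. *)
Lemma refine_sum N (G : {ffun 'I_r -> 'I_(p ^ N)} -> Cp) :
  \sum_j G j * \prod_(i < r) m N (j i) =
  \sum_j G (reduce j) * \prod_(i < r) m N.+1 (j i).
Proof.
rewrite [RHS](partition_big (@reduce N) xpredT) //=; apply: eq_bigr => j _.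
under [RHS]eq_bigr => j' /eqP -> do [].
rewrite -mulr_sumr; congr (_ * _).
under eq_bigr do rewrite (m_additive (ltn_ord _)).
rewrite bigA_distr_big_dep; apply: eq_bigl => j'.
apply/familyP/eqP => [h|<- i]; last by rewrite unfold_in ffunE.
by apply/ffunP => i; apply/val_inj; rewrite ffunE /=; apply/eqP; apply: h.
Qed.

Lemma center_sum_cauchy g e : unif_continuous g -> 0 < e ->
  exists N0, forall N, (N0 <= N)%N -> pabs (center_sum g N.+1 - center_sum g N) < e.
Proof.
move=> gc e0; have [N0 h] := gc _ e0; exists N0 => N hN.
rewrite {2}/center_sum (refine_sum (fun j => g (center j))).
apply: (@riemann_dist_lt N.+1 (fun j => g (center j))
  (fun j => g (center (reduce j)))) => // j.
apply: h => i; [exact: center_padicZ | exact: center_padicZ |].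
apply: (@le_trans _ _ (p%:R ^- N)).
  by apply: pabs_eqmod; rewrite ffunE /= modn_mod.
by rewrite -!exprVn ler_wiXn2l ?invr_ge0 ?ler0n // ltW // invp_lt1.
Qed.

(** The sums at the centres converge by refinement and completeness. Any other sample points lie
    within p^(-N) of the centres, so uniform continuity gives the same limit. *)
Lemma integral_exists g : unif_continuous g -> exists I, is_padic_integral m g I.
Proof.
move=> gc; have [I hI] : exists I, padic_cvg (center_sum g) I.
  by apply: nonarch_cvg => e; apply: center_sum_cauchy.
exists I => e e0; have [N1 h1] := (abs_cvgP _ _).1 hI _ e0; have [N2 h2] := gc _ e0.
exists (maxn N1 N2) => N; rewrite geq_max => /andP[hN1 hN2] t tP.
apply: pabs_dist_lt (h1 _ hN1).
apply: (@riemann_dist_lt N (fun j => g (t j)) (fun j => g (center j))) => // j.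
apply: h2 => i; [by case: (tP j i) | exact: center_padicZ |].
apply: le_trans (ball_tag_close j i tP) _.
by rewrite -!exprVn ler_wiXn2l ?invr_ge0 ?ler0n // ltW // invp_lt1.
Qed.

(** Specialising the sample points to centres makes the integral the limit of one sequence, through
    which bounds and membership in Z_p pass. *)
Lemma integral_cvg g (I : Cp) : is_padic_integral m g I ->
  padic_cvg (center_sum g) I.
Proof.
move=> h; apply/abs_cvgP => e /h [N0 hN]; exists N0 => N /hN; apply.
exact: center_tag.
Qed.

Lemma integral_le g (I : Cp) B : is_padic_integral m g I ->
  (forall x : 'I_r -> Cp, (forall i, padicZ Cp (x i)) -> pabs (g x) <= B) -> pabs I <= B.
Proof.
move=> /integral_cvg gI h; have B0 : 0 <= B.
  apply: (le_trans (pabs_ge0 (g (fun=> 0)))); apply: h => i; exact: padicZ0.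
apply: (abs_cvg_le (N0 := 0) gI) => N _; apply: pabs_sum_le => // j _.
apply: le_trans (h (center j) (center_padicZ j)).
by rewrite pabsM ler_piMr ?pabs_ge0 // (pabs_prod_measure_le1 N (fun i => j i)).
Qed.

Lemma integral_padicZ g (I : Cp) : is_padic_integral m g I ->
  (forall x : 'I_r -> Cp, (forall i, padicZ Cp (x i)) -> padicZ Cp (g x)) -> padicZ Cp I.
Proof.
move=> /integral_cvg gI h; apply: (padicZ_lim gI) => N; apply: padicZ_sum => j _.
apply: padicZM; first exact: h (center_padicZ j).
by apply: padicZ_prod.
Qed.

Lemma integral_axpy f g (I J a : Cp) :
  is_padic_integral m f I -> is_padic_integral m g J ->
  is_padic_integral m (fun x : 'I_r -> Cp => f x + a * g x) (I + a * J).
Proof.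
move=> fI gJ e e0; have d0 : 0 < pabs a + 1 by rewrite ltr_wpDl ?pabs_ge0.
have [N1 h1] := fI _ e0; have [N2 h2] := gJ _ (divr_gt0 e0 d0).
exists (maxn N1 N2) => N; rewrite geq_max => /andP[hN1 hN2] t tP.
have {h1} := h1 _ hN1 _ tP; have {h2} := h2 _ hN2 _ tP.
under [X in _ -> _ -> pabs (X - _) < _]eq_bigr do rewrite mulrDl -mulrA.
rewrite big_split -mulr_sumr /=; set S := \sum_j _; set T := \sum_j _ => hS hT.
have -> : T + a * S - (I + a * J) = T - I + a * (S - J) by ring.
apply: pabsD_lt => //; rewrite pabsM.
apply: (@le_lt_trans _ _ ((pabs a + 1) * pabs (S - J))).
  by rewrite ler_wpM2r ?pabs_ge0 // lerDl.
by rewrite mulrC -ltr_pdivlMr.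
Qed.

Lemma integral0 : is_padic_integral m (fun _ : 'I_r -> Cp => 0) 0.
Proof.
move=> e e0; exists 0%N => N _ t _; rewrite big1 ?subrr ?pabs0 // => j _.
by rewrite mul0r.
Qed.

Lemma integral_sum (I : Type) (s : seq I) (w : I -> Cp) (g : I -> ('I_r -> Cp) -> Cp)
    (J : I -> Cp) : (forall i, is_padic_integral m (g i) (J i)) ->
  is_padic_integral m (fun x : 'I_r -> Cp => \sum_(i <- s) w i * g i x)
    (\sum_(i <- s) w i * J i).
Proof.
move=> h; elim: s => [|i s IH].
  by under eq_fun do rewrite big_nil; rewrite big_nil; apply: integral0.
under eq_fun do rewrite big_cons addrC; rewrite big_cons addrC.
exact: (@integral_axpy _ _ _ _ (w i) IH (h i)).
Qed.

End RiemannIntegral.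

(** * Expansion of the L-function *)

Lemma pabs_prod_dist (I : Type) (s : seq I) (F G : I -> Cp) B : 0 <= B ->
  (forall i, pabs (F i) <= 1) -> (forall i, pabs (G i) <= 1) ->
  (forall i, pabs (F i - G i) <= B) ->
  pabs (\prod_(i <- s) F i - \prod_(i <- s) G i) <= B.
Proof.
move=> B0 hF hG hFG.
(* The bounds by 1 are carried through the induction because the difference of products is split as
   x (y - y') + (x - x') y'. *)
pose P x y := [/\ pabs x <= 1, pabs y <= 1 & pabs (x - y) <= B].
suff [] : P (\prod_(i <- s) F i) (\prod_(i <- s) G i) by [].
apply: (big_ind2 P) => [|x x' y y' [x1 x'1 xx'] [y1 y'1 yy']|i _]; last by split.
  by split; rewrite ?pabs1 // subrr pabs0.
split; rewrite ?pabsM ?mulr_ile1 ?pabs_ge0 //.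
have -> : x * y - x' * y' = x * (y - y') + (x - x') * y' by ring.
apply: pabsD_le; rewrite pabsM.
  by apply: le_trans yy'; rewrite ler_piMl ?pabs_ge0.
by apply: le_trans xx'; rewrite ler_piMr ?pabs_ge0.
Qed.

Section Expansion.
Variables (r : nat) (k : 'I_r -> int) (gamma : 'I_r -> Cp).
Hypothesis gammaZ : forall j, padicZ Cp (gamma j).
Implicit Types (h : 'I_r -> Cp -> Cp) (X Y : 'I_r -> Cp).
Local Notation dot X i := (partial_dot X gamma i).
Local Notation D := (padic_L_domain gamma).

(** The argument of [h i] is the diamond part minus 1, a point of the disc |u| <= 1/q. One form thus
    covers the integrand of the L-function, those of the coefficients and the truncated
    expansions. *)
Definition twisted_prod h X : Cp :=
  \prod_(i < r) (h i (diamond (dot X i) - 1) * teich (dot X i) ^ k i).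

Lemma partial_dot_padicZ X i : (forall j, padicZ Cp (X j)) -> padicZ Cp (dot X i).
Proof. by move=> XZ; apply: padicZ_sum => j _; apply: padicZM. Qed.

Lemma partial_dot_dist X Y i B : 0 <= B -> (forall j, pabs (X j - Y j) <= B) ->
  pabs (dot X i - dot Y i) <= B.
Proof.
move=> B0 h; rewrite /partial_dot -sumrB; apply: pabs_sum_le => // j _.
rewrite -mulrBl pabsM; apply: le_trans (h j); rewrite ler_piMr ?pabs_ge0 //.
by case: (gammaZ j).
Qed.

Lemma padic_L_domainP X :
  D X <-> (forall j, padicZ Cp (X j)) /\ (forall i, pabs (dot X i) = 1).
Proof.
by split=> -[XZ h]; split=> // i; have /pabs_unitP dP := partial_dot_padicZ i XZ; apply/dP.
Qed.

(** The partial sums move by at most 1/q < 1, so units stay units. Applied in both directions, this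
    makes the indicator of the domain constant on balls of radius 1/q. *)
Lemma padic_L_domain_open X Y : (forall j, padicZ Cp (Y j)) ->
  (forall j, pabs (X j - Y j) <= q%:R^-1) -> D X -> D Y.
Proof.
move=> YZ XY /padic_L_domainP[_ X1]; apply/padic_L_domainP; split=> // i.
rewrite -(X1 i); apply: pabs_close; rewrite X1 pabsBC.
apply: (@le_lt_trans _ _ q%:R^-1); first by apply: partial_dot_dist.
have q1 : (1 < q)%N.
  by rewrite /teich_modulus; case: ifP => // _; apply: prime_gt1.
by rewrite invf_lt1 ?ltr1n // ltr0n modulus_gt0.
Qed.

(** Off the domain the partial sums may fail to be units and nothing is known about [teich] there,
    but the indicator annihilates the product. The view separates the two cases. *)
Variant integrand_spec (f : ('I_r -> Cp) -> Cp) X : Cp -> Prop :=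
| IntegrandIn of D X : integrand_spec f X (f X)
| IntegrandOut : integrand_spec f X 0.

Lemma integrandP (f : ('I_r -> Cp) -> Cp) X : integrand_spec f X (\1_D X * f X).
Proof.
rewrite indicE; have [/set_mem DX|_] := boolP (X \in D).
  by rewrite mul1r; apply: IntegrandIn.
by rewrite mul0r; apply: IntegrandOut.
Qed.

Lemma diamond_dot X i : D X -> padicZ Cp (diamond (dot X i) - 1) /\
  pabs (diamond (dot X i) - 1) <= q%:R^-1.
Proof.
move=> /padic_L_domainP[XZ X1].
have [dZ d1] := diamondP (partial_dot_padicZ i XZ) (X1 i).
by split=> //; apply: padicZB padicZ1.
Qed.

Lemma teich_dot X i : D X ->
  padicZ Cp (teich (dot X i) ^ k i) /\ pabs (teich (dot X i) ^ k i) = 1.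
Proof.
move=> /padic_L_domainP[XZ X1].
have [wZ w1 _] := teichP (partial_dot_padicZ i XZ) (X1 i).
by split; [exact: padicZXz | exact: pabsXz].
Qed.

Lemma integrand_le h X (B : 'I_r -> R) : (forall i, 0 <= B i) ->
  (forall i (u : Cp), pabs u <= q%:R^-1 -> pabs (h i u) <= B i) ->
  pabs (\1_D X * twisted_prod h X) <= \prod_i B i.
Proof.
move=> B0 hB; case: integrandP => [DX|]; last by rewrite pabs0 prodr_ge0.
rewrite pabs_prod; apply: ler_prod => i _; rewrite pabs_ge0 pabsM.
have [_ ->] := teich_dot i DX; rewrite mulr1.
by apply: hB; case: (diamond_dot i DX).
Qed.

Lemma integrand_padicZ h X :
  (forall i (u : Cp), padicZ Cp u -> pabs u <= q%:R^-1 -> padicZ Cp (h i u)) ->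
  padicZ Cp (\1_D X * twisted_prod h X).
Proof.
move=> hZ; case: integrandP => [DX|]; last exact: padicZ0.
apply: padicZ_prod => i _; apply: padicZM; last by case: (teich_dot i DX).
by have [? ?] := diamond_dot i DX; apply: hZ.
Qed.

Lemma integrand_dist h h' X B : 0 <= B ->
  (forall i (u : Cp), pabs u <= q%:R^-1 -> pabs (h i u) <= 1) ->
  (forall i (u : Cp), pabs u <= q%:R^-1 -> pabs (h' i u) <= 1) ->
  (forall i (u : Cp), pabs u <= q%:R^-1 -> pabs (h i u - h' i u) <= B) ->
  pabs (\1_D X * twisted_prod h X - \1_D X * twisted_prod h' X) <= B.
Proof.
move=> B0 h1 h'1 hh'; rewrite -mulrBr indicE.
have [/set_mem DX|_] := boolP (X \in D); last by rewrite mul0r pabs0.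
rewrite mul1r; apply: pabs_prod_dist => // i; have [_ d1] := diamond_dot i DX.
all: by rewrite -?mulrBl pabsM (teich_dot i DX).2 mulr1; auto.
Qed.

Lemma integrand_unif_continuous h :
  (forall i (u : Cp), pabs u <= q%:R^-1 -> pabs (h i u) <= 1) ->
  (forall i (u v : Cp), pabs u <= q%:R^-1 -> pabs v <= q%:R^-1 ->
     pabs (h i u - h i v) <= q%:R * pabs (u - v)) ->
  unif_continuous (fun X => \1_D X * twisted_prod h X).
Proof.
move=> h1 hl e e0.
have q0 : 0 < q%:R :> R by rewrite ltr0n modulus_gt0.
(* Being below 1/q puts X and Y on the same side of the domain with equal Teichmueller parts; being
   below e / (2 q) beats the Lipschitz constant q. The half turns a weak inequality into a strict
   one. *)
have d0 : 0 < Num.min 1 (e / 2) / q%:R by rewrite divr_gt0 // lt_min ltr01 divr_gt0.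
have ip0 : 0 <= (p%:R : R)^-1 by rewrite invr_ge0.
have [N /(_ _ (leqnn N)) hN] := geometric_lt ip0 invp_lt1 d0.
have hq : p%:R ^- N <= q%:R^-1 :> R.
  rewrite -exprVn; apply: le_trans (ltW hN) _.
  by rewrite ler_pdivrMr // mulVf ?gt_eqF // ge_min lexx.
have he : q%:R * p%:R ^- N <= e / 2.
  rewrite mulrC -ler_pdivlMr // -exprVn; apply: le_trans (ltW hN) _.
  by rewrite ler_pM2r ?invr_gt0 // ge_min lexx orbT.
exists N => X Y XZ YZ XY.
have XYq j : pabs (X j - Y j) <= q%:R^-1 by apply: le_trans (XY j) hq.
have DXY : (X \in D) = (Y \in D).
  apply/idP/idP => /set_mem H; apply/mem_set; apply: padic_L_domain_open H => //.
  by move=> j; rewrite pabsBC.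
rewrite !indicE -DXY -mulrBr; have [DX|_] := boolP (X \in D); last by rewrite mul0r pabs0.
have DY := DX; rewrite DXY in DY; move: DX DY => /set_mem DX /set_mem DY.
have pN0 : 0 <= (p%:R : R) ^- N by rewrite invr_ge0 exprn_ge0.
apply: (@le_lt_trans _ _ (e / 2)); last by rewrite ltr_pdivrMr // ltr_pMr // ltr1n.
rewrite mul1r; apply: pabs_prod_dist => [|i|i|i]; first by rewrite divr_ge0 // ltW.
- by rewrite pabsM (teich_dot i DX).2 mulr1 h1 //; case: (diamond_dot i DX).
- by rewrite pabsM (teich_dot i DY).2 mulr1 h1 //; case: (diamond_dot i DY).
have [dXZ dX1] := padic_L_domainP X; have [_ X1] := dXZ DX.
have dXY : pabs (dot X i - dot Y i) <= p%:R ^- N by apply: partial_dot_dist.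
have dZ Z : (forall j, padicZ Cp (Z j)) -> padicZ Cp (dot Z i) by apply: partial_dot_padicZ.
have dXYq := le_trans dXY hq.
rewrite -(teich_locally_constant (dZ _ XZ) (dZ _ YZ)) // -mulrBl pabsM.
rewrite (teich_dot i DX).2 mulr1; apply: le_trans he.
apply: (@le_trans _ _ (q%:R * pabs (diamond (dot X i) - 1 - (diamond (dot Y i) - 1)))).
  by apply: hl; [case: (diamond_dot i DX) | case: (diamond_dot i DY)].
rewrite ler_pM2l // opprB addrA subrK diamond_isometry //.
  exact: dZ XZ.
exact: dZ YZ.
Qed.

Lemma twisted_prod_expand (s : 'I_r -> Cp) M X :
  \1_D X * twisted_prod (fun i (u : Cp) => \sum_(m < M) pow_coef m u * s i ^+ m) X =
  \sum_(n : {ffun 'I_r -> 'I_M})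
    (\prod_i s i ^+ n i) * (\1_D X * twisted_prod (fun i => pow_coef (n i)) X).
Proof.
under [RHS]eq_bigr do rewrite mulrCA; rewrite -mulr_sumr; congr (_ * _).
rewrite /twisted_prod; under eq_bigr do rewrite mulr_suml.
rewrite bigA_distr_bigA; apply: eq_bigr => n _; rewrite -big_split.
by apply: eq_bigr => i _ /=; rewrite mulrA [_ * pow_coef _ _]mulrC.
Qed.

(** * The coefficients and the convergence of the series *)

Variables (c : nat) (hc1 : (1 < c)%N) (hcp : coprime c p).
Local Notation mu := (mtilde Cp c).

Definition L_coef (n : {ffun 'I_r -> nat}) : Cp :=
  padic_integral mu D (twisted_prod (fun i => pow_coef (n i))).

Lemma padic_integralP (f : ('I_r -> Cp) -> Cp) :
  unif_continuous (fun X => \1_D X * f X) ->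
  is_padic_integral mu (fun X => \1_D X * f X) (padic_integral mu D f).
Proof.
move=> fc; apply: (@xgetPex _ 0
  [set I | is_padic_integral mu (fun X => \1_D X * f X) I]%classic).
apply: integral_exists fc => N j; [exact: mtilde_padicZ | exact: mtilde_additive].
Qed.

Lemma pow_coef_le1 m x : pabs x <= q%:R^-1 -> pabs (pow_coef m x) <= 1.
Proof.
move=> hx; apply: le_trans (pow_coef_le m hx) _.
have /andP[r0 r1] := radiusV_lt1.
by rewrite -exprVn exprn_ile1 // ltW.
Qed.

Lemma L_coefP (n : {ffun 'I_r -> nat}) : is_padic_integral mu
  (fun X => \1_D X * twisted_prod (fun i => pow_coef (n i)) X) (L_coef n).
Proof.
apply: padic_integralP; apply: integrand_unif_continuous => i.
  exact: pow_coef_le1.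
exact: pow_coef_lipschitz.
Qed.

(** [diamond_pow] at exponent [- s i] unfolds to [pseries (gbinom (- s i))] at the diamond part
    minus 1, so the integrand of [padic_L] is a [twisted_prod] by conversion. *)
Lemma padic_LP (s : 'I_r -> Cp) : (forall j, pabs (s j) < rho) ->
  is_padic_integral mu
    (fun X => \1_D X * twisted_prod (fun i => pseries (gbinom (- s i))) X)
    (padic_L s k gamma c).
Proof.
move=> hs; apply: padic_integralP; apply: integrand_unif_continuous => i.
  by move=> u; apply: pow_le1.
by move=> u v; apply: pow_lipschitz.
Qed.

Lemma L_coef_padicZ n : padicZ Cp (L_coef n).
Proof.
apply: (integral_padicZ _ (L_coefP n)) => [N j|X XZ]; first exact: mtilde_padicZ.
by apply: integrand_padicZ => i u; apply: pow_coef_padicZ.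
Qed.

Lemma L_coef_prod_le n : pabs (L_coef n) <= \prod_i rho ^- n i.
Proof.
apply: (integral_le _ (L_coefP n)) => [N j|X XZ]; first exact: mtilde_padicZ.
apply: integrand_le => i; last by move=> u; apply: pow_coef_le.
by rewrite invr_ge0 exprn_ge0 // ltW // radius_gt0.
Qed.

Lemma L_coef_le n : pabs (L_coef n) <= rho ^- (\sum_(j < r) n j)%N.
Proof.
apply: le_trans (L_coef_prod_le n) _; rewrite -exprVn.
by under eq_bigr do rewrite -exprVn; rewrite prodrXr.
Qed.

Section Summation.
Variable s : 'I_r -> Cp.
Hypothesis hs : forall j, pabs (s j) < rho.

Local Notation theta i := (Num.max 1 (pabs (s i)) / rho).

(** Every factor theta_j^(n_j) is at most 1, so any single one bounds the product: a term is small
    as soon as one of its exponents is large. *)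
Lemma L_term_le n i : pabs (L_coef n * \prod_j s j ^+ n j) <= theta i ^+ n i.
Proof.
have th j : 0 <= theta j ^+ n j <= 1.
  have /andP[t0 t1] := exponent_ratio (hs j).
  by rewrite exprn_ge0 // exprn_ile1 // ltW.
apply: (@le_trans _ _ (\prod_j theta j ^+ n j)).
  rewrite pabsM pabs_prod.
  apply: (@le_trans _ _ (\prod_j rho ^- n j * \prod_j pabs (s j ^+ n j))).
    by rewrite ler_wpM2r ?L_coef_prod_le // prodr_ge0 // => j _; apply: pabs_ge0.
  rewrite -big_split; apply: ler_prod => j _ /=.
  have rj : 0 <= rho ^- n j by rewrite invr_ge0 exprn_ge0 // ltW // radius_gt0.
  rewrite mulr_ge0 ?pabs_ge0 //= expr_div_n mulrC ler_wpM2r // pabsX.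
  by apply: lerXn2r; rewrite ?nnegrE ?pabs_ge0 // ?le_max ?ler01 ?lexx ?orbT.
rewrite (bigD1 i) //= ler_piMr //; first by case/andP: (th i).
by apply: prodr_ile1 => j _.
Qed.

(** By linearity the difference is itself an integral, whose integrand compares the product of the
    truncated expansions with the product of the full powers; a uniform bound on it suffices. *)
Lemma L_head_le M e : 0 <= e -> (forall i, theta i ^+ M <= e) ->
  pabs (\sum_(n : {ffun 'I_r -> 'I_M})
      L_coef [ffun i => n i : nat] * \prod_j s j ^+ n j - padic_L s k gamma c) <= e.
Proof.
move=> e0 hM.
pose nat_of (n : {ffun 'I_r -> 'I_M}) := [ffun i => n i : nat].
have hI := integral_axpy (-1)
  (integral_sum (index_enum {ffun 'I_r -> 'I_M}) (fun n => \prod_j s j ^+ n j)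
     (fun n => L_coefP (nat_of n)))
  (padic_LP hs).
under eq_bigr do rewrite mulrC.
rewrite -[X in _ + X]mulN1r; apply: (integral_le _ hI) => [N j|X XZ].
  exact: mtilde_padicZ.
have -> : \sum_(n : {ffun 'I_r -> 'I_M}) (\prod_j s j ^+ n j) *
    (\1_D X * twisted_prod (fun i => pow_coef (nat_of n i)) X) =
    \1_D X * twisted_prod (fun i (u : Cp) => \sum_(m < M) pow_coef m u * s i ^+ m) X.
  rewrite twisted_prod_expand; apply: eq_bigr => n _.
  congr (_ * (_ * _)); apply: eq_bigr => i _; by rewrite ffunE.
rewrite mulN1r; apply: integrand_dist => // i u hu.
- apply: pabs_sum_le => // m _; apply: le_trans (pow_coef_term_le (s i) m hu) _.
  by have /andP[t0 t1] := exponent_ratio (hs i); rewrite exprn_ile1 // ltW.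
- exact: pow_le1.
- exact: le_trans (pow_expansion (hs i) M hu) (hM i).
Qed.

Lemma L_expansion : abs_sum_to (@pabs R p Cp)
  (fun n : {ffun 'I_r -> nat} => L_coef n * \prod_(j < r) s j ^+ n j)
  (padic_L s k gamma c).
Proof.
move=> e e0; have e20 : 0 < e / 2 by rewrite divr_gt0.
have /fin_all_exists [N hN] : forall i, exists N, forall n, (N <= n)%N -> theta i ^+ n < e / 2.
  by move=> i; have /andP[t0 t1] := exponent_ratio (hs i); apply: geometric_lt.
pose M := \max_(i < r) N i; have hM i n : (M <= n)%N -> theta i ^+ n < e / 2.
  by move=> Mn; apply: hN; apply: leq_trans Mn; apply: leq_bigmax.
pose nat_of (n : {ffun 'I_r -> 'I_M}) : {ffun 'I_r -> nat} := [ffun i => n i : nat].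
pose box := [seq nat_of n | n <- index_enum {ffun 'I_r -> 'I_M}].
pose small (n : {ffun 'I_r -> nat}) := [forall i, n i < M]%N.
have boxP n : (n \in box) = small n.
  apply/mapP/forallP => [[n' _ ->] i|h]; first by rewrite ffunE.
  exists [ffun i => Ordinal (h i)]; first exact: mem_index_enum.
  by apply/ffunP => i; rewrite !ffunE.
have box_uniq : uniq box.
  rewrite map_inj_uniq ?index_enum_uniq // => n n' /ffunP h.
  by apply/ffunP => i; apply: val_inj; have := h i; rewrite !ffunE.
exists [fset n in box]%fset => F /fsubsetP F0.
have e2 : e / 2 < e by rewrite ltr_pdivrMr // ltr_pMr // ltr1n.
(* Since F contains the box, its indices with all entries below M form exactly the box and give the
   truncated sum. Any other index has an entry at least M, so its term is small. *)
rewrite (bigID small) /= addrAC; apply: pabsD_lt; last first.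
  apply: pabs_sum_lt => // n; rewrite negb_forall => /existsP[i]; rewrite -leqNgt => Mn.
  by apply: le_lt_trans (L_term_le n i) (lt_trans (hM i _ Mn) e2).
apply: le_lt_trans e2; have := @L_head_le M (e / 2) (ltW e20).
rewrite -big_filter (perm_big box) /=; last first.
  apply: uniq_perm => //; first by rewrite filter_uniq // fset_uniq.
  move=> n; rewrite mem_filter boxP; case: (boolP (small n)) => //= sn.
  by rewrite F0 // inE boxP.
rewrite big_map; under [X in _ -> pabs (X - _) <= _]eq_bigr => n _.
  rewrite (eq_bigr (fun j => s j ^+ n j)); last by move=> j _; rewrite ffunE.
  over.
by apply => i; apply/ltW/hM.
Qed.

End Summation.
End Expansion.

End PadicL.

Theorem theorem2p14 (R : realType) (p : nat) (hp : prime p)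
    (Cp : padicComplexType R p) (r : nat) (hr : (0 < r)%N)
    (k : 'I_r -> int) (gamma : 'I_r -> Cp) (hgamma : forall j, padicZ Cp (gamma j))
    (c : nat) (hc1 : (1 < c)%N) (hcp : coprime c p) :
  exists C : {ffun 'I_r -> nat} -> Cp,
    (forall n, padicZ Cp (C n)) /\
    (forall n, pabs (C n) <= padic_radius R p ^- (\sum_(j < r) n j)%N) /\
    (forall s : 'I_r -> Cp, (forall j, pabs (s j) < padic_radius R p) ->
       abs_sum_to (@pabs R p Cp)
         (fun n : {ffun 'I_r -> nat} => C n * \prod_(j < r) s j ^+ n j)
         (padic_L s k gamma c)).
Proof.
exists (L_coef k gamma c); split; first exact: L_coef_padicZ.
by split; [exact: L_coef_le | move=> s; apply: L_expansion].
Qed.
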